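(* Let $w\in W_n$ and let $t\in W_n$ be the generator with $t(1)=-1$, $t(i)=i$ for $i\ge2$. Then $$p({}^-\vec w)^{\mathrm{ev}}=p({}^-\overrightarrow{tw})^{\mathrm{ev}}=p({}^-\overrightarrow{wt})^{\mathrm{ev}}.$$ Concretely, $\overrightarrow{tw}$ is obtained from $\vec w$ by changing the sign of the entry equal to $\pm1$, and $\overrightarrow{wt}$ is obtained from $\vec w$ by changing the sign of its first entry.
   Context: $W_n$ is the group of permutations $w$ of $\{\pm1,\dots,\pm n\}$ with $w(-i)=-w(i)$; products are compositions. $\vec w=(w(1),\dots,w(n))$ and ${}^-\vec w=(-w(n),\dots,-w(1),w(1),\dots,w(n))$. $p(x)$ denotes the shape of the Robinson–Schensted tableau of the integer sequence $x$ (row insertion; an inserted entry bumps the leftmost entry strictly greater). For a partition $r$, $r^{\mathrm{ev}}=(r_1^{\mathrm{ev}},r_2^{\mathrm{ev}},\dots)$ with $r_i^{\mathrm{ev}}=\lceil r_i/2\rceil$ for $i$ odd and $\lfloor r_i/2\rfloor$ for $i$ even. *)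

(* Defs.v *)
From mathcomp Require Import all_boot all_order all_algebra.
Set Implicit Arguments. Unset Strict Implicit. Unset Printing Implicit Defensive.
Import Order.TTheory GRing.Theory Num.Theory.
Local Open Scope ring_scope.

(* An element w of W_n is represented by its window vec w = (w(1),...,w(n)),
   a sequence of integers whose absolute values are a permutation of 1..n. *)
Definition signed_perm (n : nat) (s : seq int) : bool :=
  (size s == n) && perm_eq [seq `|x|%N | x <- s] (iota 1 n).

(* the action of w (given by its window s) on {+-1,...,+-n}: w(-i) = -w(i) *)
Definition sp_app (s : seq int) (i : int) : int :=
  if 0 < i then nth 0 s (`|i|.-1)%N else - nth 0 s (`|i|.-1)%N.

Definition sp_mul (n : nat) (s1 s2 : seq int) : seq int :=
  [seq sp_app s1 (sp_app s2 (Posz i)) | i <- iota 1 n].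

Definition gen_t (n : nat) : seq int :=
  [seq (if i == 1%N then -1 else Posz i) | i <- iota 1 n].

Definition minus_vec (s : seq int) : seq int := [seq - x | x <- rev s] ++ s.

Fixpoint row_insert (x : int) (row : seq int) : option int * seq int :=
  match row with
  | [::] => (None, [:: x])
  | y :: r => if x < y then (Some y, x :: r)
              else let: (b, r') := row_insert x r in (b, y :: r')
  end.

Fixpoint tab_insert (x : int) (t : seq (seq int)) : seq (seq int) :=
  match t with
  | [::] => [:: [:: x]]
  | row :: t' => let: (b, row') := row_insert x row in
                 match b with
                 | None => row' :: t'
                 | Some y => row' :: tab_insert y t'
                 end
  end.

Definition RS_tableau (x : seq int) : seq (seq int) :=
  foldl (fun t a => tab_insert a t) [::] x.

Definition RS_shape (x : seq int) : seq nat := map size (RS_tableau x).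

(* r^ev, as a function of the (1-based) row index i; parts beyond the length
   of r are 0. Index j here is 0-based: j = i - 1. *)
Definition ev_part (r : seq nat) (j : nat) : nat :=
  let ri := nth 0%N r j in
  if odd j then (ri %/ 2)%N       (* i = j+1 even: floor *)
  else (ri.+1 %/ 2)%N.            (* i = j+1 odd : ceil *)

(* Main.v *)
Require Import Defs.
From mathcomp Require Import all_boot all_order all_algebra.
From mathcomp Require Import zify.
Set Implicit Arguments. Unset Strict Implicit. Unset Printing Implicit Defensive.
Import Order.TTheory GRing.Theory Num.Theory.

(** Since [r^ev_i] is the number of cells [(i, j)] of row [i] with [i + j] even,
    the claim is that the two diagrams have the same even cells.

    Write [x] for the doubled word of [w].  By Greene's theorem its shape does not
    change when [x] is reversed and negated, and it is transposed when [x] is only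
    negated.  Remove from [x] the last letter [c] of [w] and [-c], and the letters
    [M] and [-M] of largest absolute value.  The shapes of the intermediate words
    are related by Fomin's local rules, and the symmetry of [x] forces the shape of
    [x] to be determined as follows: the two removals yield pairs of cells, one even
    and one odd; if the pairs are disjoint, all four cells are added, and otherwise
    a domino is pushed into the next row or column.

    Let now the letter of smallest absolute value [m] of [w] change its sign.  By
    induction the even cells of the three smaller shapes do not change, and this
    determines the even cells of the shape of [x], unless both removals add the same
    even cell and the domino is pushed into a row for one word and into a column for
    the other one.  Exchanging the adjacent values [-m] and [m] changes the number of
    cells in the first [k] rows by at most one, always in the same direction, and
    this excludes the remaining bad configuration.  The statement for [wt] is the
    statement for [t w^-1], as a permutation and its inverse have the same shape. *)

(** * Greene's invariants and Knuth moves *)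

Definition star (x : seq int) : seq int := [seq - a | a <- rev x]%R.

Definition color_lt (k : nat) (col : int -> nat) (a b : int) : bool :=
  (col a == col b) && (col a < k) ==> (a < b)%R.

(* The letters of color j < k form k disjoint increasing subsequences of x;
   letters of color at least k are not used. *)
Definition greene (k : nat) (x : seq int) (m : nat) : Prop :=
  exists2 col, pairwise (color_lt k col) x & m <= count (fun a => col a < k) x.

(** Knuth equivalence in arbitrary contexts; strict inequalities are enough for words with distinct
    letters. *)
Inductive knuth : seq int -> seq int -> Prop :=
| KnuthBAC u v (a b c : int) : (a < b)%R -> (b < c)%R ->
    knuth (u ++ [:: b; a; c] ++ v) (u ++ [:: b; c; a] ++ v)
| KnuthACB u v (a b c : int) : (a < b)%R -> (b < c)%R ->
    knuth (u ++ [:: a; c; b] ++ v) (u ++ [:: c; a; b] ++ v)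
| KnuthRefl x : knuth x x
| KnuthSym x y : knuth x y -> knuth y x
| KnuthTrans x y z : knuth x y -> knuth y z -> knuth x z.

Lemma knuth_perm x y : knuth x y -> perm_eq x y.
Proof.
elim=> [u v a b c _ _|u v a b c _ _|//|x' y' _|x' y' z' _ IH1 _ IH2].
- by rewrite perm_cat2l perm_cat2r; apply/permP=> p /=; lia.
- by rewrite perm_cat2l perm_cat2r; apply/permP=> p /=; lia.
- by rewrite perm_sym.
- exact: perm_trans IH1 IH2.
Qed.

Lemma knuth_cat u x y v : knuth x y -> knuth (u ++ x ++ v) (u ++ y ++ v).
Proof.
move=> K; elim: K u v => [u0 v0 a b c ab bc|u0 v0 a b c ab bc|x0|x0 y0 _ IH|x0 y0 z0 _ IH1 _ IH2] u v.
- by have := KnuthBAC (u ++ u0) (v0 ++ v) ab bc; rewrite !catA -?catA /= -?catA.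
- by have := KnuthACB (u ++ u0) (v0 ++ v) ab bc; rewrite !catA -?catA /= -?catA.
- exact: KnuthRefl.
- exact: KnuthSym.
- exact: KnuthTrans (IH1 _ _) (IH2 _ _).
Qed.

(** Reading backwards exchanges the two Knuth relations. *)
Lemma knuth_rev x y : knuth x y -> knuth (rev x) (rev y).
Proof.
elim=> [u v a b c ab bc|u v a b c ab bc|x0|x0 y0 _ IH|x0 y0 z0 _ IH1 _ IH2].
- rewrite !rev_cat -!catA; apply/KnuthSym; exact: (KnuthACB (rev v) (rev u) ab bc).
- rewrite !rev_cat -!catA; apply/KnuthSym; exact: (KnuthBAC (rev v) (rev u) ab bc).
- exact: KnuthRefl.
- exact: KnuthSym.
- exact: KnuthTrans IH1 IH2.
Qed.

Lemma starK : involutive star.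
Proof. by move=> x; rewrite /star -map_rev revK -map_comp map_id_in // => a _ /=; rewrite opprK. Qed.

Lemma star_cat x y : star (x ++ y) = star y ++ star x.
Proof. by rewrite /star rev_cat map_cat. Qed.

Lemma pairwise_rev (T : Type) (r : rel T) s :
  pairwise r (rev s) = pairwise (fun a b => r b a) s.
Proof.
elim: s => //= a s IH.
by rewrite rev_cons pairwise_rcons IH all_rev.
Qed.

(** Reversing and negating together keep increasing subsequences increasing; each letter takes over
    the color of its negative. *)
Lemma greene_star k x m : greene k x m -> greene k (star x) m.
Proof.
case=> col Hp Hc; exists (fun a => col (- a)%R); last first.
  rewrite /star count_map count_rev; apply: leq_trans Hc _.
  by rewrite leq_eqVlt; apply/orP; left; apply/eqP/eq_count => a /=; rewrite opprK.
rewrite /star pairwise_map pairwise_rev; apply: sub_pairwise Hp => a b /=.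
rewrite /color_lt !opprK ltrN2 => /implyP H; apply/implyP => /andP [/eqP e lt].
by apply: H; rewrite -e eqxx.
Qed.

(** Isolates the conditions on three consecutive letters: up to order, a Knuth move affects only the
    last group. *)
Lemma pairwise_mid3 (T : eqType) (R : rel T) u v a b c :
  pairwise R (u ++ [:: a; b; c] ++ v) <->
  [/\ pairwise R u, pairwise R v, {in u & v, forall y z, R y z},
      ((forall y, y \in u -> [/\ R y a, R y b & R y c]) /\
       (forall y, y \in v -> [/\ R a y, R b y & R c y])) &
      [/\ R a b, R a c & R b c]].
Proof.
rewrite !pairwise_cat allrel_catr.
have -> : pairwise R [:: a; b; c] = [&& R a b, R a c & R b c] by rewrite /= !andbT -andbA.
split.
  case/and3P => /andP [/allrelP Ha /allrelP Hb] Hu.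
  case/and3P => /allrelP Hc /and3P [-> -> ->] Hv; split=> //.
  split=> y Hy; first by split; apply: Ha; rewrite ?inE ?eqxx ?orbT.
  by split; apply: Hc; rewrite ?inE ?eqxx ?orbT.
case=> -> -> Huv [Hu Hv] [-> -> ->]; rewrite !andbT.
apply/andP; split; first (apply/andP; split).
- by apply/allrelP => y z Hy; rewrite !inE => /or3P [] /eqP ->; case: (Hu y Hy).
- by apply/allrelP.
- by apply/allrelP => y z; rewrite !inE => /or3P [] /eqP -> Hz; case: (Hv z Hz).
Qed.

Lemma color_ltP k col a b :
  reflect (col a = col b -> col a < k -> (a < b)%R) (color_lt k col a b).
Proof.
apply: (iffP implyP) => [H e l|H /andP [/eqP e l]]; last exact: H.
by apply: H; rewrite e eqxx -e.
Qed.

Lemma pairwise_color_sub k col col' x :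
  {in x &, forall y z, col' y = col' z -> col' y < k -> col y = col z /\ col y < k} ->
  pairwise (color_lt k col) x -> pairwise (color_lt k col') x.
Proof.
move=> H; apply: (sub_in_pairwise (P := mem x)); last by apply/allP.
move=> y z Hy Hz /color_ltP Hc; apply/color_ltP => e l.
by have [] := H y z Hy Hz e l; apply: Hc.
Qed.

(* If a and c share a color, then either b is free and replaces a, or the tails
   of the subsequences through b and through a, c are exchanged. *)
Lemma greene_bac k u v (a b c : int) m : (a < b)%R -> (b < c)%R ->
  uniq (u ++ [:: b; a; c] ++ v) ->
  greene k (u ++ [:: b; a; c] ++ v) m -> greene k (u ++ [:: b; c; a] ++ v) m.
Proof.
move=> ab bc Hu [col /pairwise_mid3 [Pu Pv Puv [Pul Pvl] [Pba Pbc Pac]] Hc].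
have ac := lt_trans ab bc.
have [au bu cu] : [/\ a \notin u, b \notin u & c \notin u].
  move: Hu; rewrite cat_uniq => /and3P [_ /hasPn H _].
  by split; apply: H; rewrite !inE eqxx ?orbT.
have [av bv cv] : [/\ a \notin v, b \notin v & c \notin v].
  move: Hu; rewrite catA cat_uniq => /and3P [_ /hasPn H _].
  by split; apply/negP => /H /=; rewrite mem_cat !inE eqxx ?orbT.
have uv y : y \in u -> y \notin v.
  move=> Hy; apply/negP => Hv; move: Hu; rewrite cat_uniq => /and3P [_ /hasPn H _].
  by have := H y; rewrite mem_cat Hv orbT Hy => /(_ isT).
(* Unless [a] and [c] share a used color, the old coloring survives, as only the order of [a] and
   [c] changes. *)
have [/andP [/eqP E ak]|N] := boolP ((col a == col c) && (col a < k)); last first.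
  exists col; last by move: Hc; rewrite !count_cat /=; clear; lia.
  apply/pairwise_mid3; split=> //.
  + by split=> y Hy; [case: (Pul y Hy)|case: (Pvl y Hy)].
  + by split=> //; apply/implyP => /andP [/eqP e l]; move: N; rewrite -e eqxx l.
have ba' : (b == a) = false by apply/eqP => e; rewrite e ltxx in ab.
have cb' : (c == b) = false by apply/eqP => e; rewrite e ltxx in bc.
have ca' : (c == a) = false by apply/eqP => e; rewrite e ltxx in ac.
have Qu y : y \in u -> (col y = col b -> col y < k -> (y < b)%R) /\
                       (col y = col a -> (y < a)%R).
  move=> Hy; have [/color_ltP Hb /color_ltP Ha _] := Pul y Hy; split=> // e.
  by apply: Ha => //; rewrite e.
have Qv y : y \in v -> (col y = col b -> col y < k -> (b < y)%R) /\
                       (col y = col a -> (c < y)%R).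
  move=> Hy; have [/color_ltP Hb _ /color_ltP Hc'] := Pvl y Hy; split=> e.
    by rewrite e; apply: Hb.
  by apply: Hc'; rewrite -E.
have Quv y z : y \in u -> z \in v -> col y = col z -> col y < k -> (y < z)%R.
  by move=> Hy Hz; apply/color_ltP/Puv.
have [bk|bk] := leqP k (col b).
  pose col' y := if y == b then col a else if y == a then k else col y.
  have eu y : y \in u -> col' y = col y.
    move=> Hy; rewrite /col'; case: eqP => [e|_]; first by rewrite -e Hy in bu.
    by case: eqP => [e|_] //; rewrite -e Hy in au.
  have ev y : y \in v -> col' y = col y.
    move=> Hy; rewrite /col'; case: eqP => [e|_]; first by rewrite -e Hy in bv.
    by case: eqP => [e|_] //; rewrite -e Hy in av.
  have ea : col' a = k by rewrite /col' eqxx eq_sym ba'.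
  have eb : col' b = col a by rewrite /col' eqxx.
  have ec : col' c = col a by rewrite /col' cb' ca'.
  exists col'.
    apply/pairwise_mid3; split.
    - by apply: pairwise_color_sub Pu => y z Hy Hz; rewrite !eu.
    - by apply: pairwise_color_sub Pv => y z Hy Hz; rewrite !ev.
    - by move=> y z Hy Hz; apply/color_ltP; rewrite eu ?ev //; apply: Quv.
    - split=> y Hy.
        have [H1 H2] := Qu y Hy.
        by split; apply/color_ltP; rewrite (eu y Hy) ?ea ?eb ?ec; clear -ab bc ak bk H1 H2; lia.
      have [H1 H2] := Qv y Hy.
      by split; apply/color_ltP; rewrite (ev y Hy) ?ea ?eb ?ec; clear -ab bc ak bk H1 H2; lia.
    - by split; apply/color_ltP; rewrite ?ea ?eb ?ec; clear -ab bc ak bk ba'; lia.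
  have cu' : count (fun y => col' y < k) u = count (fun y => col y < k) u.
    by apply: eq_in_count => y Hy; rewrite eu.
  have cv' : count (fun y => col' y < k) v = count (fun y => col y < k) v.
    by apply: eq_in_count => y Hy; rewrite ev.
  by move: Hc; rewrite !count_cat cu' cv' /= ea eb ec -E; clear -ak bk; lia.
(* [b] stands before the smaller letter [a], so they cannot share a used color. *)
have nAB : col a <> col b.
  by move=> e; move/color_ltP: Pba => /(_ (esym e) bk); clear -ab; lia.
(* New subsequences: up to [b] as before, then [c] and the old continuation of [c]; up to [a] as
   before, then the old continuation of [b]. *)
pose sw j := if j == col a then col b else if j == col b then col a else j.
pose col' y := if y \in v then sw (col y) else if y == c then col b else col y.
have eu y : y \in u -> col' y = col y.
  by move=> Hy; rewrite /col' (negbTE (uv y Hy)); case: eqP => // e; rewrite -e Hy in cu.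
have ev y : y \in v -> col' y = sw (col y) by move=> Hy; rewrite /col' Hy.
have ea : col' a = col a by rewrite /col' (negbTE av) eq_sym ca'.
have eb : col' b = col b by rewrite /col' (negbTE bv) eq_sym cb'.
have ec : col' c = col b by rewrite /col' (negbTE cv) eqxx.
exists col'.
  apply/pairwise_mid3; split.
  - by apply: pairwise_color_sub Pu => y z Hy Hz; rewrite !eu.
  - by apply: pairwise_color_sub Pv => y z Hy Hz; rewrite !ev // /sw;
       do ?case: eqP; clear -ak bk nAB; lia.
  - move=> y z Hy Hz; apply/color_ltP; rewrite eu ?ev // /sw.
    have [H1 H2] := Qu y Hy; have [H3 H4] := Qv z Hz; have H5 := Quv y z Hy Hz.
    by do ?case: eqP; clear -ab bc ak bk nAB H1 H2 H3 H4 H5; lia.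
  - split=> y Hy.
      have [H1 H2] := Qu y Hy.
      by split; apply/color_ltP; rewrite (eu y Hy) ?ea ?eb ?ec; clear -ab bc ak bk H1 H2; lia.
    have [H1 H2] := Qv y Hy.
    by split; apply/color_ltP; rewrite (ev y Hy) ?ea ?eb ?ec /sw; do ?case: eqP; clear -ab bc ak bk nAB H1 H2; lia.
  - by split; apply/color_ltP; rewrite ?ea ?eb ?ec; clear -ab bc ak bk nAB; lia.
have cu' : count (fun y => col' y < k) u = count (fun y => col y < k) u.
  by apply: eq_in_count => y Hy; rewrite eu.
have cv' : count (fun y => col' y < k) v = count (fun y => col y < k) v.
  by apply: eq_in_count => y Hy; rewrite ev // /sw; do ?case: eqP; clear -ak bk nAB; lia.
by move: Hc; rewrite !count_cat cu' cv' /= ea eb ec -E; clear -ak bk; lia.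
Qed.

(** The same coloring works: the only reordered pair becomes [a], [c], which is increasing. *)
Lemma greene_bca k u v (a b c : int) m : (a < b)%R -> (b < c)%R ->
  greene k (u ++ [:: b; c; a] ++ v) m -> greene k (u ++ [:: b; a; c] ++ v) m.
Proof.
move=> ab bc [col /pairwise_mid3 [Pu Pv Puv [Pul Pvl] [Pbc Pba Pca]] Hc].
exists col; last by move: Hc; rewrite !count_cat /=; clear; lia.
apply/pairwise_mid3; split=> //.
  by split=> y Hy; [case: (Pul y Hy)|case: (Pvl y Hy)].
by split=> //; apply/color_ltP => _ _; apply: lt_trans ab bc.
Qed.

Lemma star_mid u v (a b c : int) :
  star (u ++ [:: a; b; c] ++ v) = star v ++ [:: - c; - b; - a]%R ++ star u.
Proof. by rewrite !star_cat -catA. Qed.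

Lemma star_uniq x : uniq (star x) = uniq x.
Proof. by rewrite /star map_inj_uniq ?rev_uniq //; apply: oppr_inj. Qed.

(** The second Knuth relation is the first one conjugated by [star], so [greene_star] reduces it to
    the first. *)
Lemma greene_knuth k x y m : knuth x y -> uniq x -> greene k x m <-> greene k y m.
Proof.
move=> K; elim: K => [u v a b c ab bc|u v a b c ab bc|x0|x0 y0 Kx IH|x0 y0 z0 Kx IH1 _ IH2] Ux.
- by split; [apply: greene_bac|apply: greene_bca].
- have ab' : (- c < - b)%R by rewrite ltrN2.
  have bc' : (- b < - a)%R by rewrite ltrN2.
  split=> /greene_star; rewrite star_mid => H; rewrite -[u ++ _]starK;
    apply/greene_star; rewrite star_mid.
    by apply: greene_bac H; rewrite -?star_mid ?star_uniq.
  exact: greene_bca H.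
- by [].
- have Uy : uniq x0 by rewrite (perm_uniq (knuth_perm Kx)).
  exact: iff_sym (IH Uy).
- have Uy : uniq y0 by rewrite -(perm_uniq (knuth_perm Kx)).
  exact: iff_trans (IH1 Ux) (IH2 Uy).
Qed.

(** * Robinson-Schensted tableaux *)

Local Notation increasing := (pairwise (fun a b : int => a < b)%R).

Fixpoint row_above (r s : seq int) {struct s} : bool :=
  match s, r with
  | [::], _ => true
  | b :: s', a :: r' => (a < b)%R && row_above r' s'
  | _ :: _, [::] => false
  end.

(** Trailing empty rows are allowed, so that deleting the first column by [behead] yields a tableau
    again. *)
Fixpoint is_tableau (t : seq (seq int)) : bool :=
  if t is r :: t' then [&& increasing r, row_above r (head [::] t') & is_tableau t']
  else true.

Lemma row_insert_perm x r :
  perm_eq ((if (row_insert x r).1 is Some y then [:: y] else [::]) ++ (row_insert x r).2) (x :: r).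
Proof.
elim: r => //= y r IH; case: ifP => _ /=; first by apply/permP => p /=; lia.
case: (row_insert x r) IH => b r' /= /permP IH; apply/permP => p /=.
by have := IH p; rewrite !count_cat /=; lia.
Qed.

Lemma row_insert_cases x r : x \notin r -> increasing r ->
  match row_insert x r with
  | (None, r') => r' = rcons r x /\ increasing r'
  | (Some y, r') => [/\ increasing r', perm_eq (y :: r') (x :: r), (x < y)%R
                      & head 0%R r' <= x /\ size r' = size r ]%R
  end.
Proof.
elim: r => [|a r IH] //=; rewrite inE negb_or => /andP [xa xr] /andP [ar ir].
case: ifP => lt_xa /=.
  split=> //.
  - by rewrite ir andbT; apply/allP => z /(allP ar); apply: lt_trans.
  - by apply/permP => p /=; lia.
have ax : (a < x)%R by rewrite lt_neqAle eq_sym xa leNgt lt_xa.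
move: (IH xr ir); case: (row_insert x r) => [[y|] r'] /=.
  case=> ir' P xy [_ sz]; split=> //.
  - rewrite ir' andbT; apply/allP => z Hz.
    have : z \in x :: r by rewrite -(perm_mem P) inE Hz orbT.
    by rewrite inE => /predU1P [->|/(allP ar)].
  - by apply/permP => p /=; move/permP/(_ p): P => /=; lia.
  - by split; [exact: ltW|rewrite sz].
case=> -> ir'; split=> //; rewrite ir' andbT all_rcons ax.
exact: ar.
Qed.

Lemma size_row_above r s : row_above r s -> size s <= size r.
Proof. by elim: s r => [|b s IH] [|a r] //= /andP [_ /IH]. Qed.

Lemma row_above_nth r s j : row_above r s -> j < size s -> (nth 0 r j < nth 0 s j)%R.
Proof. by elim: s r j => [|b s IH] [|a r] [|j] //= /andP [ab rs] // js; apply: IH. Qed.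

Lemma row_above_rcons r s x : row_above r s -> row_above (rcons r x) s.
Proof. by elim: s r => [|b s IH] [|a r] //= /andP [-> /IH ->]. Qed.

Lemma row_above_insert x r s y r' : row_insert x r = (Some y, r') ->
  row_above r s -> row_above r' s.
Proof.
elim: r s r' => [|a r IH] //= [|b s] r'; first by [].
case: ifP => lt_xa; first by case=> _ <- /= /andP [ab ->]; rewrite (lt_trans lt_xa ab).
case: (row_insert x r) IH => [o r1] IH [eo <-] /= /andP [-> ?].
by apply: IH => //; rewrite eo.
Qed.

(** The bumped letter [y] is smaller than the entry under it, if any, so it lands in [s] weakly to
    the left of its old column, below a smaller letter. *)
Lemma row_above_bump x r s y r' : x \notin r -> increasing r -> increasing s ->
  row_above r s -> row_insert x r = (Some y, r') ->
  row_above r' (row_insert y s).2.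
Proof.
elim: r s r' => [|a r IH] //= s r'.
rewrite inE negb_or => /andP [xa xr] /andP [ar ir] is_ rs.
case: ifP => lt_xa.
  case=> <- <-; case: s is_ rs => [|b s] //=; first by rewrite lt_xa.
  by move=> _ /andP [-> ?] /=; rewrite lt_xa.
have := row_insert_cases xr ir.
case E: (row_insert x r) => [o r1] Hr [eo <-]; rewrite eo in E Hr.
case: Hr => ir1 P xy _.
have ay : (a < y)%R.
  have : y \in x :: r by rewrite -(perm_mem P) inE eqxx.
  rewrite inE => /predU1P [e|/(allP ar) //]; by rewrite e ltxx in xy.
case: s is_ rs => [|b s] /=; first by rewrite ay.
move=> /andP [bs iss] /andP [ab rs]; case: ifP => lt_yb /=.
  by rewrite ay (row_above_insert E).
have := IH s r1 xr ir iss rs E.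
by case: (row_insert y s) => o' s' /= ->; rewrite ab.
Qed.

Lemma tab_insert_perm x t : perm_eq (flatten (tab_insert x t)) (x :: flatten t).
Proof.
elim: t x => [|r t IH] x //=; have := row_insert_perm x r.
case: (row_insert x r) => [[y|] r'] /= P; last by rewrite -cat_cons perm_cat2r.
apply/permP => p; rewrite /= !count_cat; move/permP/(_ p): P => /=.
by move/permP/(_ p): (IH y) => /=; lia.
Qed.

Lemma head_tab_insert y t :
  head [::] (tab_insert y t) = (row_insert y (head [::] t)).2.
Proof. by case: t => //= r t; case: (row_insert y r) => [[]]. Qed.

Lemma head_increasing t : is_tableau t -> increasing (head [::] t).
Proof. by case: t => //= r t /and3P []. Qed.

Lemma tab_insert_tableau x t : uniq (x :: flatten t) -> is_tableau t ->
  is_tableau (tab_insert x t).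
Proof.
elim: t x => [|r t IH] x //= /andP [xr Ut] /and3P [ir rt tt].
have xr' : x \notin r by move: xr; rewrite mem_cat negb_or => /andP [].
have := row_insert_cases xr' ir.
case E: (row_insert x r) => [[y|] r'] /=; last first.
  by case=> -> ->; rewrite tt row_above_rcons.
case=> -> P xy _; rewrite head_tab_insert (row_above_bump xr' ir _ rt E) ?head_increasing //=.
apply: IH tt.
have : uniq (x :: r ++ flatten t) by rewrite /= xr.
rewrite -cat_cons -(perm_uniq (perm_cat P (perm_refl _))) /=.
by rewrite mem_cat negb_or cat_uniq => /andP [/andP [_ ->] /and3P [_ _ ->]].
Qed.

Lemma RS_rcons x a : RS_tableau (rcons x a) = tab_insert a (RS_tableau x).
Proof. exact: foldl_rcons. Qed.

Lemma RS_perm x : perm_eq (flatten (RS_tableau x)) x.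
Proof.
elim/last_ind: x => // x a IH; rewrite RS_rcons.
apply: perm_trans (tab_insert_perm _ _) _.
by rewrite perm_sym perm_rcons perm_cons perm_sym.
Qed.

Lemma RS_is_tableau x : uniq x -> is_tableau (RS_tableau x).
Proof.
elim/last_ind: x => // x a IH Ux; rewrite RS_rcons.
apply: tab_insert_tableau; last by apply: IH; move: Ux; rewrite rcons_uniq => /andP [].
by move: Ux; rewrite rcons_uniq /= (perm_mem (RS_perm x)) (perm_uniq (RS_perm x)).
Qed.

Definition reading_word (t : seq (seq int)) : seq int := flatten (rev t).

Lemma reading_word_cons r t : reading_word (r :: t) = reading_word t ++ r.
Proof. by rewrite /reading_word rev_cons flatten_rcons. Qed.

Lemma perm_reading_word t : perm_eq (reading_word t) (flatten t).
Proof. by apply: perm_flatten; rewrite perm_rev. Qed.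

Lemma knuth_cons a x y : knuth x y -> knuth (a :: x) (a :: y).
Proof. by move=> K; have := knuth_cat [:: a] [::] K; rewrite !cats0. Qed.

(** Each passage of [x] across a letter uses the preceding letter as middle value; therefore the
    first letter is not passed. *)
Lemma knuth_slide x a r : (x < a)%R -> increasing (a :: r) ->
  knuth (a :: rcons r x) (a :: x :: r).
Proof.
elim: r a => [|b r IH] a xa; first by move=> _; apply: KnuthRefl.
rewrite /= => /andP [/andP [ab _] /andP [br ir]].
have xb : (x < b)%R := lt_trans xa ab.
apply: KnuthTrans (knuth_cons a (IH b xb _)) _; first by rewrite /= br.
apply/KnuthSym; exact: (KnuthBAC [::] r xa ab).
Qed.

Lemma knuth_row_insert x r y r' : x \notin r -> increasing r ->
  row_insert x r = (Some y, r') -> knuth (rcons r x) (y :: r').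
Proof.
elim: r r' => [|a r IH] //= r'.
rewrite inE negb_or => /andP [xa xr] /andP [ar ir].
case: ifP => lt_xa.
  by case=> <- <-; apply: knuth_slide => //=; rewrite ar.
have ax : (a < x)%R by rewrite lt_neqAle eq_sym xa leNgt lt_xa.
have := row_insert_cases xr ir.
case E: (row_insert x r) => [o r1] Hr [eo <-]; rewrite eo in E Hr.
case: Hr => ir1 P xy [hx sz].
apply: KnuthTrans (knuth_cons a (IH _ xr ir E)) _.
case: r1 E ir1 P hx sz => [|z r1] E ir1 P /= hx sz.
  by case: r {IH ar ir} sz xr E P.
have az : (a < z)%R.
  have : z \in x :: r by rewrite -(perm_mem P) !inE eqxx orbT.
  by rewrite inE => /predU1P [->|/(allP ar)].
(* The bumped letter [y] passes [a] with [z] as middle value, since [a < z <= x < y]. *)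
exact: (KnuthACB [::] r1 az (le_lt_trans hx xy)).
Qed.

Lemma knuth_tab_insert x t : uniq (x :: flatten t) -> is_tableau t ->
  knuth (rcons (reading_word t) x) (reading_word (tab_insert x t)).
Proof.
elim: t x => [|r t IH] x /=; first by move=> *; apply: KnuthRefl.
move=> /andP [xr Ut] /and3P [ir rt tt].
have xr' : x \notin r by move: xr; rewrite mem_cat negb_or => /andP [].
have := row_insert_cases xr' ir.
case E: (row_insert x r) => [[y|] r'] /=; last first.
  by case=> -> _; rewrite !reading_word_cons rcons_cat; apply: KnuthRefl.
case=> _ P xy _; rewrite !reading_word_cons rcons_cat.
have := knuth_cat (reading_word t) [::] (knuth_row_insert xr' ir E).
rewrite !cats0 => /KnuthTrans; apply.
suff /(knuth_cat [::] r') : knuth (rcons (reading_word t) y) (reading_word (tab_insert y t)).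
  by rewrite !cat0s cat_rcons.
apply: IH tt.
have : uniq (x :: r ++ flatten t) by rewrite /= xr.
rewrite -cat_cons -(perm_uniq (perm_cat P (perm_refl _))) /=.
by rewrite mem_cat negb_or cat_uniq => /andP [/andP [_ ->] /and3P [_ _ ->]].
Qed.

Lemma knuth_RS x : uniq x -> knuth x (reading_word (RS_tableau x)).
Proof.
elim/last_ind: x => [|x a IH]; first by move=> _; apply: KnuthRefl.
move=> Ux; have := Ux; rewrite rcons_uniq => /andP [ax Ux'].
rewrite RS_rcons; apply: KnuthTrans (knuth_tab_insert _ _).
- have := knuth_cat [::] [:: a] (IH Ux'); by rewrite /= !cats1.
- by rewrite /= (perm_mem (RS_perm x)) (perm_uniq (RS_perm x)) ax.
- exact: RS_is_tableau.
Qed.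

(** * Greene's theorem *)

(** The used letters have distinct colors, all below [k]. *)
Lemma count_colors_le k (col : int -> nat) s :
  pairwise (fun a b => ~~ ((col a == col b) && (col a < k))) s ->
  count (fun a => col a < k) s <= minn k (size s).
Proof.
move=> P; rewrite leq_min count_size andbT -size_filter.
rewrite -(size_map col) -{2}(size_iota 0 k); apply: uniq_leq_size; last first.
  by move=> j /mapP [a]; rewrite mem_filter => /andP [ak _] ->; rewrite mem_iota.
elim: s P => //= a s IH /andP [Pa /IH U]; case: ifP => //= ak; rewrite U andbT.
apply/negP => /mapP [b]; rewrite mem_filter => /andP [_ bs] e.
by have := allP Pa b bs; rewrite e eqxx -e ak.
Qed.

(** The lower bound in Greene's theorem: the rows are increasing, and letters are colored by their
    row index. *)
Lemma greene_rows k t : is_tableau t -> uniq (flatten t) ->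
  greene k (reading_word t) (\sum_(i < k) size (nth [::] t i)).
Proof.
elim: t k => [|r t IH] k /=.
  move=> _ _; exists (fun=> 0) => //; rewrite big1 // => i _.
  by rewrite nth_nil.
case: k => [|k].
  move=> _ _; exists (fun=> 0); last by rewrite big_ord0.
  by elim: (reading_word _) => //= a s ->; rewrite andbT; apply/allP => b _; apply/color_ltP.
case/and3P => ir rt tt; rewrite cat_uniq => /and3P [Ur /hasPn rtU Ut].
have [col P C] := IH k tt Ut.
have nr a : a \in reading_word t -> a \notin r.
  by rewrite (perm_mem (perm_reading_word t)) => /rtU.
pose col' a := if a \in r then 0 else (col a).+1.
exists col'; rewrite reading_word_cons ?pairwise_cat.
  apply/and3P; split.
  - apply/allrelP => a b /nr na br; apply/color_ltP.
    by rewrite /col' br (negbTE na).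
  - apply: (sub_in_pairwise (P := mem (reading_word t))) P; last by apply/allP.
    move=> a b /nr na /nr nb /color_ltP H; apply/color_ltP.
    by rewrite /col' (negbTE na) (negbTE nb) => -[e]; rewrite ltnS; apply: H.
  - by apply: sub_pairwise ir => a b ab; apply/color_ltP.
rewrite count_cat big_ord_recl /= addnC leq_add //.
  apply: leq_trans C _; rewrite leq_eqVlt; apply/orP; left; apply/eqP.
  by apply: eq_in_count => a /nr na; rewrite /col' (negbTE na) ltnS.
by rewrite (@eq_in_count _ _ predT) ?count_predT // => a ar; rewrite /col' ar.
Qed.

(** The first column; [pmap] skips the empty rows. *)
Definition heads (t : seq (seq int)) : seq int := pmap ohead t.

Lemma mem_heads t b : b \in heads t -> b \in flatten t.
Proof.
elim: t => //= -[|a r] t IH /=; first exact: IH.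
by rewrite !inE mem_cat => /orP [->|/IH ->]; rewrite ?orbT.
Qed.

Lemma heads_gt a r t b : row_above (a :: r) (head [::] t) -> is_tableau t ->
  b \in heads t -> (a < b)%R.
Proof.
elim: t a r => //= -[|c s] t IH a r; last first.
  move=> /andP [ac _] /and3P [_ cst tt]; rewrite inE => /predU1P [->//|Hb].
  exact: lt_trans ac (IH _ _ cst tt Hb).
move=> _ /and3P [_ Ht tt]; apply: (IH a r) => //.
by case: t Ht {IH tt} => [|[|? ?] t].
Qed.

(** The nonempty rows of a tableau come first. *)
Lemma heads_lt t i : is_tableau t -> (0 < size (nth [::] t i)) = (i < size (heads t)).
Proof.
elim: t i => [|[|a r] t IH] [|i] //=; try by rewrite nth_nil.
- case/andP => Ht tt; rewrite -(IH 0 tt); case: t Ht {IH tt} => [|[|? ?] ?] //.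
- case/andP => Ht tt; rewrite (IH i tt).
  have : size (heads t) = 0; last by move=> ->.
  by apply/eqP; rewrite -leqn0 leqNgt -(IH 0 tt); case: t Ht {IH tt} => [|[|? ?] ?].
- by case/and3P => _ _ tt; rewrite (IH i tt).
Qed.

Lemma behead_tableau t : is_tableau t -> is_tableau (map behead t).
Proof.
elim: t => //= r t IH /and3P [ir rt /IH ->]; rewrite andbT; apply/andP; split.
  by case: r ir {rt} => //= a r /andP [].
by case: t rt {IH} => [|[|b s] t] //=; case: r {ir} => //= a r /andP [].
Qed.

Lemma flatten_heads t : perm_eq (flatten t) (heads t ++ flatten (map behead t)).
Proof.
elim: t => //= -[|a r] t IH //=; rewrite perm_cons.
by rewrite perm_sym perm_catCA perm_cat2l perm_sym.
Qed.

Lemma subseq_reading_behead t : subseq (reading_word (map behead t)) (reading_word t).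
Proof.
elim: t => //= r t IH; rewrite !reading_word_cons; apply: cat_subseq => //.
by case: r => //= a r; apply: subseq_cons.
Qed.

(** The reading word goes up the first column and meets decreasing letters, no two of which lie in
    one increasing subsequence. *)
Lemma heads_colors k col t : is_tableau t ->
  pairwise (color_lt k col) (reading_word t) ->
  pairwise (fun a b => ~~ ((col a == col b) && (col a < k))) (heads t).
Proof.
elim: t => //= r t IH /and3P [ir rt tt].
rewrite reading_word_cons pairwise_cat => /and3P [/allrelP Hrt /(IH tt) Ht _].
case: r ir rt Hrt => //= a r _ rt Hrt; rewrite Ht andbT.
apply/allP => b Hb; apply/negP => /andP [/eqP e l].
have : color_lt k col b a.
  by apply: Hrt; rewrite ?inE ?eqxx // (perm_mem (perm_reading_word t)) mem_heads.
move/color_ltP => /(_ (esym e)); rewrite -e => /(_ l).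
by rewrite ltNge le_eqVlt (heads_gt rt tt Hb) orbT.
Qed.

(* In the reading word the columns are decreasing, so each column has at most
   one letter of each color; the columns are peeled off from the left. *)
Lemma greene_rows_le k t m : is_tableau t -> greene k (reading_word t) m ->
  m <= \sum_(i < k) size (nth [::] t i).
Proof.
move=> tt [col P C]; apply: leq_trans C _.
rewrite (permP (perm_reading_word t)).
(* Induction on the number of columns, that is, on the length of the first row. *)
have [n] := ubnP (size (head [::] t)).
elim: n t tt P => // n IH t tt P Hn.
rewrite (permP (flatten_heads t)) count_cat.
(* The first [k] rows meet the first column in [minn k (size (heads t))] cells. *)
have -> : \sum_(i < k) size (nth [::] t i) =
  minn k (size (heads t)) + \sum_(i < k) size (nth [::] (map behead t) i).
  transitivity (\sum_(i < k) ((i < size (heads t)) + size (nth [::] (map behead t) i))).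
    apply: eq_bigr => i _; rewrite -heads_lt //.
    have [it|it] := ltnP i (size t); last by rewrite !nth_default ?size_map.
    by rewrite (nth_map [::]) // size_behead; case: (size _).
  rewrite big_split /=; congr (_ + _).
  elim: k {IH P} => [|k IHk]; first by rewrite big_ord0 min0n.
  by rewrite big_ord_recr /= IHk; case: ltnP; lia.
apply: leq_add; first exact/count_colors_le/heads_colors.
have [e|ne] := posnP (size (head [::] t)).
  have h0 : size (heads t) = 0.
    by apply/eqP; rewrite -leqn0 leqNgt -heads_lt // nth0 e.
  have : flatten (map behead t) = [::].
    apply/eqP; rewrite -size_eq0 size_flatten /shape sumnE big1_seq // => j.
    case/andP => _ /mapP [r0 /mapP [r rt ->] ->]; rewrite size_behead.
    have := heads_lt (index r t) tt; rewrite nth_index // h0; by case: (size r).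
  by move=> ->.
apply: IH; first exact: behead_tableau.
- exact: subseq_pairwise (subseq_reading_behead t) P.
- by case: t ne Hn {tt P} => //= -[|a r] t.
Qed.

Lemma rev_reading_word_cons r t :
  rev (reading_word (r :: t)) = rev r ++ rev (reading_word t).
Proof. by rewrite reading_word_cons rev_cat. Qed.

(** Read backwards, each row is decreasing, so it has at most one letter of each used color. *)
Lemma greene_cols_le k t m : is_tableau t -> greene k (rev (reading_word t)) m ->
  m <= \sum_(r <- t) minn k (size r).
Proof.
move=> tt [col P C]; apply: leq_trans C _; elim: t tt P => //= r t IH.
case/and3P => ir _ tt; rewrite rev_reading_word_cons pairwise_cat.
case/and3P => _ Pr /(IH tt) Pt; rewrite big_cons count_cat leq_add //.
rewrite count_rev; apply: count_colors_le; move: Pr; rewrite pairwise_rev => Pr.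
have : pairwise [rel a b | (a < b)%R && color_lt k col b a] r.
  by rewrite pairwise_relI ir.
apply: sub_pairwise => a b /= /andP [ab /color_ltP H]; apply/negP => /andP [/eqP e l].
by have := H (esym e); rewrite -e => /(_ l); rewrite ltNge (ltW ab).
Qed.

Fixpoint column_of (t : seq (seq int)) (a : int) : nat :=
  if t is r :: t' then if a \in r then index a r else column_of t' a else 0.

Lemma column_above r t b : row_above r (head [::] t) -> is_tableau t ->
  b \in flatten t ->
  column_of t b < size r /\ (nth 0 r (column_of t b) < b)%R.
Proof.
elim: t r => //= s t IH r rs /and3P [_ st tt]; rewrite mem_cat.
have szs := size_row_above rs.
case: ifP => [bs _|_ /= bt].
  have lt_i : index b s < size s by rewrite index_mem.
  by split; [exact: leq_trans lt_i szs|have := row_above_nth rs lt_i; rewrite nth_index].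
have [h1 h2] := IH s st tt bt.
by split; [exact: leq_trans h1 szs|exact: lt_trans (row_above_nth rs h1) h2].
Qed.

(** The lower bound for the reversed word: it visits the rows from the top, so the columns are
    increasing subsequences, and the first [k] of them take [minn k (size r)] letters from each row
    [r]. *)
Lemma greene_cols k t : is_tableau t -> uniq (flatten t) ->
  greene k (rev (reading_word t)) (\sum_(r <- t) minn k (size r)).
Proof.
move=> tt Ut; exists (column_of t).
  elim: t tt Ut => //= r t IH /and3P [ir rt tt].
  rewrite cat_uniq => /and3P [Ur /hasPn rtU Ut].
  rewrite rev_reading_word_cons pairwise_cat; apply/and3P; split.
  - apply/allrelP => a b; rewrite !mem_rev (perm_mem (perm_reading_word t)) => ar bt.
    apply/color_ltP; rewrite ar (negbTE (rtU _ bt)) => e _.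
    by have [_] := column_above rt tt bt; rewrite -e nth_index.
  - rewrite pairwise_rev; apply/(pairwiseP 0%R) => i j; rewrite !inE => Hi Hj ij.
    apply/color_ltP; rewrite !mem_nth // !index_uniq //; lia.
  - have := IH tt Ut; apply: (sub_in_pairwise (P := mem (flatten t))).
      move=> a b at_ bt; rewrite /color_lt.
      by rewrite (negbTE (rtU _ at_)) (negbTE (rtU _ bt)).
    by apply/allP => a; rewrite mem_rev (perm_mem (perm_reading_word t)).
rewrite count_rev (permP (perm_reading_word t)).
elim: t tt Ut => [|r t IH] /=; first by rewrite big_nil.
case/and3P => ir rt tt; rewrite cat_uniq => /and3P [Ur /hasPn rtU Ut].
rewrite big_cons count_cat leq_add //; last first.
  apply: leq_trans (IH tt Ut) _; rewrite leq_eqVlt; apply/orP; left; apply/eqP.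
  by apply: eq_in_count => a at_; rewrite (negbTE (rtU _ at_)).
rewrite -[X in minn k X](size_iota 0) -size_filter.
rewrite (@eq_in_filter _ _ (fun a => index a r < k)); last by move=> a ->.
rewrite size_filter.
suff -> : count (fun a => index a r < k) r = minn k (size r) by rewrite size_iota.
elim: (r) k Ur {ir rt rtU IH} => [|a s IHs] k /=; first by rewrite minn0.
case/andP => as_ Us; rewrite eqxx; case: k => [|k].
  by rewrite min0n; apply/eqP; rewrite eqn0Ngt -has_count; apply/hasPn.
rewrite minnSS -(IHs k Us); congr _.+1; apply: eq_in_count => b bs.
by case: eqP => // e; rewrite e bs in as_.
Qed.

Definition row_len (x : seq int) (i : nat) : nat := nth 0 (RS_shape x) i.

Lemma row_lenE x i : row_len x i = size (nth [::] (RS_tableau x) i).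
Proof.
rewrite /row_len /RS_shape.
have [lt_i|ge_i] := ltnP i (size (RS_tableau x)); first by rewrite (nth_map [::]).
by rewrite !nth_default ?size_map.
Qed.

(** Knuth moves carry [x] to the reading word of its tableau, for which the first [k] rows are
    optimal. *)
Theorem greene_theorem k x m : uniq x ->
  greene k x m <-> m <= \sum_(i < k) row_len x i.
Proof.
move=> Ux; have tt := RS_is_tableau Ux.
have Ut : uniq (flatten (RS_tableau x)) by rewrite (perm_uniq (RS_perm x)).
have -> : \sum_(i < k) row_len x i = \sum_(i < k) size (nth [::] (RS_tableau x) i).
  by apply: eq_bigr => i _; apply: row_lenE.
apply: iff_trans (greene_knuth k m (knuth_RS Ux) Ux) _; split.
  exact: greene_rows_le.
by have [col P C] := greene_rows k tt Ut => H; exists col => //; apply: leq_trans H C.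
Qed.

(** Reversal respects Knuth equivalence, and for the reversed reading word the first [k] columns are
    optimal. *)
Theorem greene_theorem_rev k x m : uniq x ->
  greene k (rev x) m <-> m <= \sum_(r <- RS_tableau x) minn k (size r).
Proof.
move=> Ux; have tt := RS_is_tableau Ux.
have Ut : uniq (flatten (RS_tableau x)) by rewrite (perm_uniq (RS_perm x)).
have Ur : uniq (rev x) by rewrite rev_uniq.
apply: iff_trans (greene_knuth k m (knuth_rev (knuth_RS Ux)) Ur) _; split.
  exact: greene_cols_le.
by have [col P C] := greene_cols k tt Ut => H; exists col => //; apply: leq_trans H C.
Qed.

(** Greene's invariants give the partial sums of the row lengths, hence the lengths. *)
Lemma eq_row_len x y : uniq x -> uniq y ->
  (forall k m, greene k x m <-> greene k y m) -> row_len x =1 row_len y.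
Proof.
move=> Ux Uy H.
have S k : \sum_(i < k) row_len x i = \sum_(i < k) row_len y i.
  apply/eqP; rewrite eqn_leq; apply/andP; split.
    by apply/(greene_theorem _ _ Uy)/H/(greene_theorem _ _ Ux).
  by apply/(greene_theorem _ _ Ux)/H/(greene_theorem _ _ Uy).
by move=> k; have := S k.+1; rewrite !big_ord_recr /= S => /addnI.
Qed.

Lemma row_len_star x : uniq x -> row_len (star x) =1 row_len x.
Proof.
move=> Ux; apply: eq_row_len => //; first by rewrite star_uniq.
by move=> k m; split=> /greene_star //; rewrite starK.
Qed.

Lemma row_len_noninc x i j : uniq x -> i <= j -> row_len x j <= row_len x i.
Proof.
move=> Ux ij; rewrite !row_lenE.
have := RS_is_tableau Ux; elim: (RS_tableau x) i j ij => [|r t IH] i j ij /=.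
  by rewrite !nth_nil.
case/and3P => _ rt tt; case: j ij => [|j] ij.
  by move: ij; rewrite leqn0 => /eqP ->.
case: i ij => [|i] ij /=; last exact: IH.
apply: leq_trans (IH 0 j _ tt) _ => //; rewrite nth0; exact: size_row_above.
Qed.

(** The sum of the [minn k (size r)] counts the cells in the first [k] columns; its successive
    differences are the column lengths. *)
Lemma row_len_rev x j : uniq x ->
  row_len (rev x) j = count (fun r => j < size r) (RS_tableau x).
Proof.
move=> Ux; have Ur : uniq (rev x) by rewrite rev_uniq.
have S k : \sum_(i < k) row_len (rev x) i = \sum_(r <- RS_tableau x) minn k (size r).
  apply/eqP; rewrite eqn_leq; apply/andP; split.
    by apply/(greene_theorem_rev _ _ Ux)/(greene_theorem _ _ Ur).
  by apply/(greene_theorem _ _ Ur)/(greene_theorem_rev _ _ Ux).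
have := S j.+1; rewrite big_ord_recr /= S => H.
apply: (@addnI (\sum_(r <- RS_tableau x) minn j (size r))); rewrite H.
rewrite -sum1_count (big_mkcond (fun r : seq int => j < size r)) -big_split /=.
by apply: eq_bigr => r _; case: ltnP; lia.
Qed.

(** * Diagrams, and insertion in the presence of a largest letter *)

Definition diagram (x : seq int) (c : nat * nat) : bool := c.2 < row_len x c.1.

Lemma diagram_rev x i j : uniq x -> diagram (rev x) (j, i) = diagram x (i, j).
Proof.
move=> Ux; rewrite /diagram /= row_len_rev //.
rewrite (row_lenE x).
have M a b : a <= b -> size (nth [::] (RS_tableau x) b) <= size (nth [::] (RS_tableau x) a).
  by move=> ab; rewrite -!row_lenE row_len_noninc.
elim: (RS_tableau x) i M => [|r t IH] i M /=; first by rewrite nth_nil.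
have Mt a b : a <= b -> size (nth [::] t b) <= size (nth [::] t a) by apply: (M a.+1 b.+1).
have [jr|rj] := ltnP j (size r).
  by case: i => [|i] /=; rewrite ?jr // add1n ltnS; apply: IH.
have -> : count (fun r0 => j < size r0) t = 0.
  apply/eqP; rewrite eqn0Ngt -has_count; apply/hasPn => s /(nthP [::]) [b _ <-].
  by rewrite -leqNgt; apply: leq_trans (M 0 b.+1 isT) rj.
by apply/esym/negbTE; rewrite -leqNgt; apply: leq_trans (M 0 i isT) rj.
Qed.

(** Negation is reversal followed by [star]; the first transposes the diagram, the second preserves
    it. *)
Lemma diagram_opp x i j : uniq x ->
  diagram [seq - a | a <- x]%R (j, i) = diagram x (i, j).
Proof.
move=> Ux; have Uo : uniq [seq - a | a <- x]%R by rewrite map_inj_uniq //; apply: oppr_inj.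
by rewrite -diagram_rev // -map_rev /diagram /= row_len_star.
Qed.

Definition ideal (A : nat * nat -> bool) : Prop :=
  forall i j i' j', i' <= i -> j' <= j -> A (i, j) -> A (i', j').

Lemma diagram_ideal x : uniq x -> ideal (diagram x).
Proof.
move=> Ux i j i' j' ii jj; rewrite /diagram /= => H.
by apply: leq_trans (row_len_noninc Ux ii); apply: leq_ltn_trans jj H.
Qed.

Definition add_cell (p : nat * nat) (A B : nat * nat -> bool) : Prop :=
  ~~ A p /\ forall c, B c = A c || (c == p).

(* M at the end of row i, where i may be the first empty row. *)
Definition append_at (M : int) (i : nat) (t : seq (seq int)) : seq (seq int) :=
  set_nth [::] t i (rcons (nth [::] t i) M).

(** The row that receives the new cell when [x] is inserted. *)
Fixpoint end_row (x : int) (t : seq (seq int)) : nat :=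
  if t is r :: t' then
    if (row_insert x r).1 is Some y then (end_row y t').+1 else 0
  else 0.

Lemma size_append_at M i t k :
  size (nth [::] (append_at M i t) k) = size (nth [::] t k) + (k == i).
Proof. by rewrite nth_set_nth /=; case: eqP => [->|]; rewrite ?size_rcons ?addn1 ?addn0. Qed.

Lemma size_row_insert x r :
  size (row_insert x r).2 = size r + ((row_insert x r).1 == None).
Proof.
elim: r => //= a r IH; case: ifP => //= _; first by rewrite addn0.
by case: (row_insert x r) IH => o r' /= ->.
Qed.

Lemma size_tab_insert x t k :
  size (nth [::] (tab_insert x t) k) = size (nth [::] t k) + (k == end_row x t).
Proof.
elim: t x k => [|r t IH] x [|k] //=; try by rewrite ?nth_nil.
- by have := size_row_insert x r; case: (row_insert x r) => [[y|] r'].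
- by case: (row_insert x r) => [[y|] r'] /=; rewrite ?IH ?addn0.
Qed.

Lemma row_insert_max x r : all (fun a => a < x)%R r -> row_insert x r = (None, rcons r x).
Proof. by elim: r => //= a r IH /andP [ax /IH ->]; rewrite ltNge (ltW ax). Qed.

Lemma tab_insert_max x t : all (fun a => a < x)%R (flatten t) -> tab_insert x t = append_at x 0 t.
Proof.
by case: t => //= r t; rewrite all_cat => /andP [H _]; rewrite row_insert_max.
Qed.

Lemma row_insert_rcons_max c M r : (c < M)%R -> all (fun a => a < M)%R r ->
  row_insert c (rcons r M) =
    if row_insert c r is (Some y, r') then (Some y, rcons r' M) else (Some M, rcons r c).
Proof.
move=> cM; elim: r => [|a r IH] /=; first by rewrite cM.
case/andP => aM /IH ->; case: ifP => // _.
by case: (row_insert c r) => [[y|] r'].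
Qed.

Lemma row_insert_none x r r' : row_insert x r = (None, r') -> r' = rcons r x.
Proof.
elim: r r' => [|a r IH] r' /=; first by case=> <-.
case: ifP => // _; case: (row_insert x r) IH => o r1 IH [eo <-].
by rewrite (IH r1) ?eo.
Qed.

(** The insertion of [c] does not notice [M] before its last row. If that is the row of [M], then
    [M] is bumped and, being largest, ends the next row. *)
Lemma tab_insert_append_at c M i t : (c < M)%R -> all (fun a => a < M)%R (flatten t) ->
  tab_insert c (append_at M i t) =
  append_at M (if end_row c t == i then i.+1 else i) (tab_insert c t).
Proof.
elim: t c i => [|r t IH] c i cM /=.
  by case: i => [|i] _; rewrite /append_at /= ?cM //= !nth_nil /= set_nth_nil.
rewrite all_cat => /andP [rM tM].
have P := row_insert_perm c r.
have yM y r' : row_insert c r = (Some y, r') -> (y < M)%R.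
  move=> e; have : y \in c :: r by rewrite -(perm_mem P) e inE eqxx.
  by rewrite inE => /predU1P [->//|/(allP rM)].
case: i => [|i] /=; last first.
  case E: (row_insert c r) => [[y|] r'] //=.
  by rewrite /append_at /= in IH *; rewrite IH ?(yM _ _ E) //; case: eqP => [->|ne]; case: eqP => // -[].
rewrite row_insert_rcons_max //.
case E: (row_insert c r) => [[y|] r'] //=.
by rewrite (row_insert_none E) tab_insert_max.
Qed.

(** * Local rules *)

Local Notation remove M := (filter (predC1 (M : int))).

(** On arrival [M] ends the first row; by [tab_insert_append_at] a later insertion leaves it in
    place or moves it to the end of the next row. *)
Lemma RS_max y M : uniq y -> M \in y -> all (fun a => a <= M)%R y ->
  exists i, RS_tableau y = append_at M i (RS_tableau (remove M y)).
Proof.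
elim/last_ind: y => // y a IH; rewrite rcons_uniq mem_rcons inE all_rcons.
case/andP => ay Uy + /andP [aM yM]; case: eqVneq => [e _|Ma /= My].
  rewrite e; exists 0; rewrite filter_rcons /= eqxx /= RS_rcons.
  have -> : remove a y = y.
    by apply/all_filterP/allP => b /= by_; apply: contraNneq ay => <-.
  apply: tab_insert_max; rewrite (perm_all _ (RS_perm y)).
  apply/allP => b by_; rewrite lt_neqAle; apply/andP; split; last first.
    by rewrite -e; apply: (allP yM).
  by apply: contraNneq ay => <-.
have [i Ei] := IH Uy My yM.
rewrite filter_rcons /= eq_sym Ma /= !RS_rcons Ei tab_insert_append_at; first by eexists.
  by rewrite lt_neqAle eq_sym Ma.
rewrite (perm_all _ (RS_perm _)); apply/allP => b; rewrite mem_filter /= => /andP [bM by_].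
by rewrite lt_neqAle bM (allP yM).
Qed.

Lemma add_cell_row x y i : (forall k, row_len y k = row_len x k + (k == i)) ->
  add_cell (i, row_len x i) (diagram x) (diagram y).
Proof.
move=> H; split; first by rewrite /diagram /= ltnn.
case=> k j; rewrite /diagram /= H xpair_eqE; case: (k =P i) => [->|_] /=.
  by rewrite addn1 ltnS leq_eqVlt orbC.
by rewrite addn0 orbF.
Qed.

(** Fomin's local rule: distinct new cells are united, and a repeated one pushes the last cell into
    the next row. Its column then follows as soon as [D] is a diagram. *)
Definition row_square (A B C D : nat * nat -> bool) : Prop :=
  exists p q, [/\ add_cell p A B, add_cell q A C &
    if p == q then exists2 s, s.1 = p.1.+1 & add_cell s B D else add_cell q B D].

Definition col_square (A B C D : nat * nat -> bool) : Prop :=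
  exists p q, [/\ add_cell p A B, add_cell q A C &
    if p == q then exists2 s, s.2 = p.2.+1 & add_cell s B D else add_cell q B D].

Lemma eq_add_cell p A B A' B' : A =1 A' -> B =1 B' -> add_cell p A B -> add_cell p A' B'.
Proof. by move=> eA eB [nA HB]; split=> [|c]; rewrite -?eA -?eB. Qed.

Lemma eq_row_square A B C D A' B' C' D' :
  A =1 A' -> B =1 B' -> C =1 C' -> D =1 D' -> row_square A B C D -> row_square A' B' C' D'.
Proof.
move=> eA eB eC eD [p [q [h1 h2 h3]]]; exists p, q; split.
- exact: eq_add_cell h1.
- exact: eq_add_cell h2.
- case: ifP h3 => _ h3; last exact: eq_add_cell h3.
  by case: h3 => s e h; exists s => //; apply: eq_add_cell h.
Qed.

Lemma eq_col_square A B C D A' B' C' D' :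
  A =1 A' -> B =1 B' -> C =1 C' -> D =1 D' -> col_square A B C D -> col_square A' B' C' D'.
Proof.
move=> eA eB eC eD [p [q [h1 h2 h3]]]; exists p, q; split.
- exact: eq_add_cell h1.
- exact: eq_add_cell h2.
- case: ifP h3 => _ h3; last exact: eq_add_cell h3.
  by case: h3 => s e h; exists s => //; apply: eq_add_cell h.
Qed.

Definition swap (c : nat * nat) : nat * nat := (c.2, c.1).

Lemma swapK : involutive swap. Proof. by case. Qed.

Lemma add_cell_swap p A B : add_cell p A B -> add_cell (swap p) (A \o swap) (B \o swap).
Proof.
case=> nA HB; split=> [|c] /=; first by rewrite swapK.
by rewrite HB; congr (_ || _); apply/eqP/eqP => [<-|->]; rewrite swapK.
Qed.

Lemma row_square_swap A B C D : row_square A B C D ->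
  col_square (A \o swap) (B \o swap) (C \o swap) (D \o swap).
Proof.
case=> p [q [h1 h2 h3]]; exists (swap p), (swap q); split; try exact: add_cell_swap.
rewrite (inj_eq (can_inj swapK)); case: ifP h3 => _ h3; last exact: add_cell_swap.
by case: h3 => s e h; exists (swap s) => //; apply: add_cell_swap.
Qed.

(** [tab_insert_append_at] read on shapes: the new cells lie in the rows [end_row c t] and [i], and
    equality of these rows is the repeated-cell case. *)
Lemma row_square_last_max y c M : uniq (rcons y c) -> M \in y ->
  all (fun a => a <= M)%R (rcons y c) ->
  row_square (diagram (remove M y)) (diagram (rcons (remove M y) c))
             (diagram y) (diagram (rcons y c)).
Proof.
rewrite rcons_uniq all_rcons => /andP [cy Uy] My /andP [cM yM].
have cM' : (c < M)%R by rewrite lt_neqAle cM andbT; apply: contraNneq cy => ->.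
have [i Ei] := RS_max Uy My yM.
set t := RS_tableau (remove M y) in Ei.
have tM : all (fun a => a < M)%R (flatten t).
  rewrite (perm_all _ (RS_perm _)); apply/allP => b; rewrite mem_filter /= => /andP [bM by_].
  by rewrite lt_neqAle bM (allP yM).
have lB k : row_len (rcons (remove M y) c) k = row_len (remove M y) k + (k == end_row c t).
  by rewrite !row_lenE RS_rcons size_tab_insert.
have lC k : row_len y k = row_len (remove M y) k + (k == i).
  by rewrite !row_lenE Ei size_append_at.
have lD k : row_len (rcons y c) k = row_len (rcons (remove M y) c) k +
                                    (k == (if end_row c t == i then i.+1 else i)).
  by rewrite !row_lenE !RS_rcons Ei tab_insert_append_at // size_append_at.
exists (end_row c t, row_len (remove M y) (end_row c t)), (i, row_len (remove M y) i).
split; try exact: add_cell_row.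
rewrite xpair_eqE; case: eqP lD => [e|ne] /= lD.
  rewrite e eqxx; exists (i.+1, row_len (rcons (remove M y) c) i.+1) => //.
  exact: add_cell_row.
have -> : row_len (remove M y) i = row_len (rcons (remove M y) c) i.
  by rewrite lB; case: eqP => [e|]; rewrite ?addn0 //; case: ne.
exact: add_cell_row.
Qed.

Lemma remove_opp M y : remove (- M)%R [seq - a | a <- y]%R = [seq - a | a <- remove M y]%R.
Proof. by rewrite filter_map; congr map; apply: eq_filter => a /=; rewrite eqr_opp. Qed.

Lemma uniq_opp (y : seq int) : uniq [seq - a | a <- y]%R = uniq y.
Proof. by rewrite map_inj_uniq //; apply: oppr_inj. Qed.

(** Negation turns the minimum into a maximum and transposes all diagrams, so the row rule becomes
    the column rule. *)
Lemma col_square_last_min y c m : uniq (rcons y c) -> m \in y ->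
  all (fun a => m <= a)%R (rcons y c) ->
  col_square (diagram (remove m y)) (diagram (rcons (remove m y) c))
             (diagram y) (diagram (rcons y c)).
Proof.
move=> U my ym.
have Uy : uniq y by move: U; rewrite rcons_uniq => /andP [].
have Uf : uniq (rcons (remove m y) c).
  by move: U; rewrite !rcons_uniq mem_filter filter_uniq // => /andP [/negbTE ->]; rewrite andbF.
have := @row_square_last_max [seq - a | a <- y]%R (- c)%R (- m)%R.
rewrite remove_opp -!map_rcons uniq_opp => /(_ U (map_f _ my)) H.
have {}H := row_square_swap (H _).
apply: eq_col_square (H _) => [[i j]|[i j]|[i j]|[i j]|] /=;
  try by rewrite diagram_opp // ?filter_uniq.
by rewrite all_map; apply: sub_all ym => a /=; rewrite lerN2.
Qed.

Lemma remove_star M y : remove (- M)%R (star y) = star (remove M y).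
Proof. by rewrite /star remove_opp filter_rev. Qed.

Lemma star_cons c y : star (c :: y) = rcons (star y) (- c)%R.
Proof. by rewrite /star rev_cons map_rcons. Qed.

Lemma diagram_star x : uniq x -> diagram (star x) =1 diagram x.
Proof. by move=> Ux c; rewrite /diagram row_len_star. Qed.

(** [star] makes the first letter last and the minimum a maximum, and preserves the shapes. *)
Lemma row_square_first_min y c m : uniq (c :: y) -> m \in y ->
  all (fun a => m <= a)%R (c :: y) ->
  row_square (diagram (remove m y)) (diagram (c :: remove m y))
             (diagram y) (diagram (c :: y)).
Proof.
move=> U my ym.
have Uy : uniq y by case/andP: U.
have Uf : uniq (c :: remove m y).
  by move: U; rewrite /= mem_filter filter_uniq // => /andP [/negbTE -> _]; rewrite andbF.
have := @row_square_last_max (star y) (- c)%R (- m)%R.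
rewrite remove_star -!star_cons star_uniq => /(_ U) H.
apply: eq_row_square (H _ _); try by apply: diagram_star; rewrite ?filter_uniq.
  by rewrite /star map_f // mem_rev.
by rewrite /star all_map all_rev; apply: sub_all ym => a /=; rewrite lerN2.
Qed.

Lemma add_cell_inj p q A B : add_cell p A B -> add_cell q A B -> p = q.
Proof.
case=> nA HB [_ HB']; apply/eqP; have := HB' p; rewrite HB eqxx orbT.
by rewrite (negbTE nA).
Qed.

Lemma add_cell_fun p A B B' : add_cell p A B -> add_cell p A B' -> B =1 B'.
Proof. by move=> [_ H] [_ H'] c; rewrite H H'. Qed.

Lemma add_cellC p q A B C D : add_cell p A B -> add_cell q B D -> add_cell q A C ->
  add_cell p C D.
Proof.
move=> [h1 h2] [h3 h4] [h5 h6]; split=> [|c]; last by rewrite h4 h2 h6 -!orbA (orbC (c == p)).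
rewrite h6 (negbTE h1); apply: contraNneq h3 => <-; by rewrite h2 eqxx orbT.
Qed.

(** The cell under [q] would lie in [D] without being new, hence in [A], which would force [q] into
    [A]. *)
Lemma add_cell_corner_false q s A B D : ideal A -> ideal D -> add_cell q A B ->
  add_cell s B D -> s.1 = q.1.+1 -> s.2 = q.2.+1 -> False.
Proof.
case: q s => [i j] [i' j'] /= iA iD [h1 h2] [h3 h4] e1 e2; subst i' j'.
have : D (i.+1, j.+1) by rewrite h4 eqxx orbT.
move/(iD _ _ i.+1 j (leqnn _) (leqnSn _)); rewrite h4 h2 !xpair_eqE.
rewrite (gtn_eqF (ltnSn i)) (ltn_eqF (ltnSn j)) andbF !orbF.
by move/(iA _ _ i j (leqnSn _) (leqnn _)); apply/negP.
Qed.

Definition add_cells (l : seq (nat * nat)) (A B : nat * nat -> bool) : Prop :=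
  [/\ uniq l, all (fun c => ~~ A c) l & forall c, B c = A c || (c \in l)].

Lemma add_cells1 p A B : add_cell p A B -> add_cells [:: p] A B.
Proof. by case=> h1 h2; split=> [||c] //=; rewrite ?h1 // h2 inE. Qed.

Lemma add_cells_rcons l p A B C : add_cells l A B -> add_cell p B C ->
  add_cells (rcons l p) A C.
Proof.
case=> U N H [h1 h2]; move: h1; rewrite H negb_or => /andP [pA pl].
split=> [||c]; rewrite ?rcons_uniq ?pl // ?all_rcons ?pA //.
by rewrite h2 H mem_rcons inE orbAC -orbA.
Qed.

(** [L] and [Ro] stand for the words without and with both pairs of letters, [Mu] and [Nu] for those
    with one pair. In the second case [p] is repeated and pushes [s] into the next row and [t] into
    the next column; [Mu] and [Nu] each add a vertical domino [p], [s] or a horizontal domino [p],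
    [t]. The shapes [B], [P], [N] are kept to locate [s] and [t] later. *)
Variant cube_spec (L Mu Nu Ro : nat * nat -> bool) : Prop :=
| CubeDisjoint p p2 q q2 of
    add_cells [:: p; p2] L Mu & add_cells [:: q; q2] L Nu &
    add_cells [:: p; p2; q; q2] L Ro
| CubeBump p s t z B N P of
    s.1 = p.1.+1 & t.2 = p.2.+1 & z = (t.1.+1, s.2.+1) &
    add_cells [:: p; s; t; z] L Ro &
    add_cell p L B & add_cell s B P & add_cell t B N & ideal P & ideal N &
    (add_cells [:: p; s] L Mu /\ s.2 = p.2) \/ (add_cells [:: p; t] L Mu /\ t.1 = p.1) &
    (add_cells [:: p; s] L Nu /\ s.2 = p.2) \/ (add_cells [:: p; t] L Nu /\ t.1 = p.1).

(** A two-by-two grid of squares leads from [L] to [Ro]. Its central shape has two versions [P] and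
    [N], and each square obeys the row rule with one of them and the column rule with the other.
    Comparing the rules leaves two patterns. *)
Lemma cubeP L B V P N Mu Nu T U Ro :
  ideal L -> ideal B -> ideal V -> ideal P -> ideal N -> ideal T -> ideal U -> ideal Ro ->
  row_square L B V P -> col_square L B V N ->
  col_square B Mu P T -> row_square B Mu N T ->
  row_square V N Nu U -> col_square V P Nu U ->
  row_square P T U Ro -> col_square N T U Ro -> cube_spec L Mu Nu Ro.
Proof.
move=> iL iB iV iP iN iT iU iR [p [q [LB LV C1]]] [p' [q' [LB' LV' C2]]].
have e1 := add_cell_inj LB' LB; have e2 := add_cell_inj LV' LV; subst p' q'.
move=> [p2 [x [BM BP C3]]] [p2' [x' [BM' BN C4]]].
have e := add_cell_inj BM' BM; subst p2'.
move=> [y [q2 [VN VNu C5]]] [y' [q2' [VP VNu' C6]]].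
have e := add_cell_inj VNu' VNu; subst q2'.
move=> [a [b [PT PU C7]]] [a' [b' [NT NU C8]]].
(* If both first steps add [p], the row rule yields [s] and leads to [P], while the column rule
   yields [t] and leads to [N]. *)
case: eqP C1 => [epq [s es Bs]|npq Bq].
  subst q; rewrite eqxx in C2; case: C2 => t et Bt.
  have e := add_cell_inj BP Bs; subst x; have e := add_cell_inj BN Bt; subst x'.
  have VB : B =1 V := add_cell_fun LB LV.
  have e := add_cell_inj VN (eq_add_cell VB (frefl N) Bt); subst y.
  have e := add_cell_inj VP (eq_add_cell VB (frefl P) Bs); subst y'.
  have nst : s <> t.
    by move=> e; subst t; exact: (add_cell_corner_false iL iP LB Bs es et).
  (* If [p2] were neither [s] nor [t], both would be the single cell between [Mu] and [T]. If [p2]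
     is [s], that cell is [t], and comparing columns makes [p], [s] a vertical domino; the other
     case is transposed. *)
  have [TP [TN HM]] : add_cell t P T /\ (add_cell s N T /\
      ((p2 = s /\ s.2 = p.2) \/ (p2 = t /\ t.1 = p.1))).
    case: eqP C3 => [e [z ez Mz]|ns Ms].
      subst p2; have MP := add_cell_fun BM BP.
      case: eqP C4 => [//|_ Mt].
      have e := add_cell_inj Mz Mt; subst z.
      have Pt := eq_add_cell MP (frefl T) Mt; split=> //; split.
        exact: add_cellC Bs Pt Bt.
      by left; split=> //; apply: succn_inj; rewrite -ez -et.
    case: eqP C4 => [e [z ez Mz]|nt Mt]; last by have := add_cell_inj Ms Mt.
    subst p2; have MN := add_cell_fun BM BN.
    have e := add_cell_inj Mz Ms; subst z.
    have Ns := eq_add_cell MN (frefl T) Ms; split; last split=> //.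
      exact: add_cellC Bt Ns Bs.
    by right; split=> //; apply: succn_inj; rewrite -ez -es.
  have [UP [UN HN]] : add_cell t P U /\ (add_cell s N U /\
      ((q2 = s /\ s.2 = p.2) \/ (q2 = t /\ t.1 = p.1))).
    case: eqP C5 => [e [z ez Nz]|nt Nq].
      subst q2; case: eqP C6 => [//|_ Pt]; split=> //.
      have Ns := add_cellC Bs Pt Bt; split=> //.
      have e := add_cell_inj Nz Ns; subst z.
      by right; split=> //; apply: succn_inj; rewrite -ez -es.
    case: eqP C6 => [e [z ez Pz]|ns Pq].
      subst q2; have Pt := add_cellC Bt Nq Bs; split=> //; split=> //.
      have e := add_cell_inj Pz Pt; subst z.
      by left; split=> //; apply: succn_inj; rewrite -ez -et.
    have := add_cell_inj (add_cellC Bt Nq (eq_add_cell (fsym VB) (frefl _) VNu))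
                         (add_cellC Bs Pq (eq_add_cell (fsym VB) (frefl _) VNu)).
    by move=> e; case: nst.
  have e := add_cell_inj PT TP; subst a; have e := add_cell_inj PU UP; subst b.
  have e := add_cell_inj NT TN; subst a'; have e := add_cell_inj NU UN; subst b'.
  rewrite !eqxx in C7 C8.
  (* The row rule fixes the row of [z], the column rule its column. *)
  case: C7 => z ez Tz; case: C8 => z' ez' Tz'; have e := add_cell_inj Tz' Tz; subst z'.
  have LL := add_cells1 LB.
  apply: (@CubeBump _ _ _ _ p s t z B N P) => //.
  - by rewrite [z]surjective_pairing ez ez'.
  - exact: (add_cells_rcons (add_cells_rcons (add_cells_rcons LL Bs) TP) Tz).
  - by case: HM => -[e1 e2]; subst p2; [left|right]; split=> //; apply: (add_cells_rcons LL).
  - case: HN => -[e1 e2]; subst q2; [left|right]; split=> //;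
    by apply: (add_cells_rcons LL); apply: eq_add_cell VNu.
(* Now [P] and [N] coincide. A later repetition would obey both rules and put a new cell diagonally
   next to the repeated one, against [add_cell_corner_false]. *)
rewrite (introF eqP npq) in C2.
have e := add_cell_inj BP Bq; subst x; have e := add_cell_inj BN C2; subst x'.
have NP : N =1 P := add_cell_fun C2 Bq.
have e := add_cell_inj VN (add_cellC LB BN LV); subst y.
have e := add_cell_inj VP (add_cellC LB BP LV); subst y'.
case: eqP C3 => [e [s es Ms]|npq2 Mq].
  subst p2; rewrite eqxx in C4; case: C4 => s' es' Ms'.
  have e := add_cell_inj Ms' Ms; subst s'.
  by case: (add_cell_corner_false iB iT BM Ms es' es).
case: eqP C5 => [e [s es Ns]|nqp2 Nq].
  subst q2; rewrite eqxx in C6; case: C6 => s' es' Ps'.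
  have e := add_cell_inj (eq_add_cell (fsym NP) (frefl _) Ps') Ns; subst s'.
  by case: (add_cell_corner_false iV iU VN Ns es es').
have e := add_cell_inj PT (add_cellC BM Mq BP); subst a.
have e := add_cell_inj NT (add_cellC BM Mq BN); subst a'.
have e := add_cell_inj NU Nq; subst b'.
have e := add_cell_inj PU (eq_add_cell NP (frefl _) Nq); subst b.
case: eqP C7 => [e [s es Ts]|np2 Tq].
  subst q2; rewrite eqxx in C8; case: C8 => s' es' Ts'.
  have e := add_cell_inj Ts' Ts; subst s'.
  by case: (add_cell_corner_false iP iR PT Ts es es').
apply: (@CubeDisjoint _ _ _ _ p p2 q q2).
- exact: (add_cells_rcons (add_cells1 LB) BM).
- exact: (add_cells_rcons (add_cells1 LV) VNu).
- exact: (add_cells_rcons (add_cells_rcons (add_cells_rcons (add_cells1 LB) BM) Mq) Tq).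
Qed.

(** * Doubled words *)

(** The absolute values need not fill an interval, so that letters can be deleted in inductions. *)
Definition signed_word (w : seq int) : bool :=
  uniq [seq `|a|%N | a <- w] && (0%R \notin w).

Lemma minus_vecE w : minus_vec w = star w ++ w.
Proof. by []. Qed.

Lemma mem_star a w : (a \in star w) = (- a \in w)%R.
Proof.
rewrite /star; apply/mapP/idP => [[b]|H]; first by rewrite mem_rev => H ->; rewrite opprK.
by exists (- a)%R; rewrite ?mem_rev ?opprK.
Qed.

Lemma signed_word_opp w a : signed_word w -> a \in w -> (- a \in w)%R -> False.
Proof.
case/andP => U nz aw naw; suff e : a = (- a)%R.
  have a0 : a = 0%R by clear -e; lia.
  by rewrite -a0 aw in nz.
have [i iw ei] := nthP 0%R aw; have [j jw ej] := nthP 0%R naw.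
rewrite -ej -ei; congr nth; apply/eqP.
rewrite -(nth_uniq 0 _ _ U) ?size_map // !(nth_map 0%R) // ei ej.
by apply/eqP; clear; lia.
Qed.

Lemma signed_word_uniq w : signed_word w -> uniq w.
Proof. by case/andP => /map_uniq. Qed.

Lemma minus_vec_uniq w : signed_word w -> uniq (minus_vec w).
Proof.
move=> sw; rewrite minus_vecE cat_uniq star_uniq signed_word_uniq // andbT /=.
apply/hasPn => a aw; apply/negP; rewrite /= mem_star; exact: signed_word_opp aw.
Qed.

Lemma star_minus_vec w : star (minus_vec w) = minus_vec w.
Proof. by rewrite minus_vecE star_cat starK. Qed.

Lemma minus_vec_rcons w c : minus_vec (rcons w c) = (- c)%R :: rcons (minus_vec w) c.
Proof. by rewrite /minus_vec rev_rcons /= rcons_cat. Qed.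

Lemma mem_minus_vec w a : (a \in minus_vec w) = (`|a|%N \in [seq `|b|%N | b <- w]).
Proof.
rewrite minus_vecE mem_cat mem_star; apply/orP/mapP => [[H|H]|[b bw e]].
- by exists (- a)%R => //; rewrite abszN.
- by exists a.
- have [<-|<-] : b = (- a)%R \/ b = a by clear -e; lia.
    by left.
  by right.
Qed.

Definition small (M : nat) (w : seq int) : seq int := [seq a <- w | `|a|%N != M].

Lemma minus_vec_small M w : minus_vec (small M w) = small M (minus_vec w).
Proof.
rewrite /minus_vec /small filter_cat filter_map filter_rev.
by congr (map _ (rev _) ++ _); apply: eq_filter => a /=; rewrite abszN.
Qed.

Lemma signed_word_filter p w : signed_word w -> signed_word (filter p w).
Proof.
case/andP => U nz; apply/andP; split.
  exact: subseq_uniq (map_subseq _ (filter_subseq _ _)) U.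
by rewrite mem_filter negb_and nz orbT.
Qed.

Lemma signed_word_rcons w c : signed_word (rcons w c) =
  [&& signed_word w, `|c|%N \notin [seq `|b|%N | b <- w] & c != 0%R].
Proof.
rewrite /signed_word map_rcons rcons_uniq mem_rcons inE negb_or eq_sym.
by case: (uniq _); case: (_ \in _); case: (c == 0%R); case: (_ \in _).
Qed.

Lemma small_remove M x : small M x = remove (- Posz M)%R (remove (Posz M) x).
Proof.
rewrite /small -filter_predI; apply: eq_filter => a /=.
by apply/idP/idP; clear; lia.
Qed.

(** Omitting some of [c], [-c], [M], [-M] from the doubled word gives the shapes for [cubeP]. Its
    symmetry under [star] identifies enough of them for each square to obey both rules. *)
Lemma minus_vec_cube w c M : signed_word (rcons w c) ->
  M \in [seq `|a|%N | a <- w] -> all (fun a => `|a|%N <= M) (rcons w c) ->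
  cube_spec (diagram (minus_vec (small M w))) (diagram (minus_vec (rcons (small M w) c)))
            (diagram (minus_vec w)) (diagram (minus_vec (rcons w c))).
Proof.
move=> sw Mw bd.
have Ux := minus_vec_uniq sw; rewrite minus_vec_rcons in Ux.
move: sw bd; rewrite signed_word_rcons all_rcons => /and3P [sw cw c0] /andP [cM wM].
have M0 : 0 < M.
  by rewrite lt0n; apply/eqP => e; move: cM c0; rewrite e; clear; lia.
have cnM : `|c|%N != M by apply: contraNneq cw => ->.
rewrite !minus_vec_rcons minus_vec_small small_remove.
set y := minus_vec w in Ux *.
have sy : star y = y := star_minus_vec w.
have yM a : a \in y -> (- Posz M <= a <= Posz M)%R.
  rewrite mem_minus_vec => /mapP [b bw e]; have := allP wM b bw; rewrite -e; clear; lia.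
have My : Posz M \in y by rewrite mem_minus_vec.
have nMy : (- Posz M)%R \in y by rewrite mem_minus_vec abszN.
(* The two digits tell whether [-M] and [M] are kept; [star] exchanges [Y10] and [Y01]. *)
set Y10 := remove (Posz M) y; set Y01 := remove (- Posz M)%R y; set Y00 := remove (- Posz M)%R Y10.
have e00 : remove (Posz M) Y01 = Y00 by rewrite /Y00 /Y01 /Y10 -!filter_predI; apply: eq_filter => a /=; rewrite andbC.
have s10 : star Y10 = Y01 by rewrite -remove_star sy.
have s01 : star Y01 = Y10 by rewrite -s10 starK.
have s00 : star Y00 = Y00 by rewrite /Y00 -remove_star opprK s10.
have cMz : (c == Posz M)%R = false by apply/eqP => e; move: cnM; rewrite e; clear; lia.
have cMz' : (c == - Posz M)%R = false by apply/eqP => e; move: cnM; rewrite e; clear; lia.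
have ncMz : (- c == Posz M)%R = false by apply/eqP => e; move: cMz'; rewrite -e opprK eqxx.
have ncMz' : (- c == - Posz M)%R = false by rewrite eqr_opp.
have sub01 : subseq Y01 y := filter_subseq _ _.
have sub10 : subseq Y10 y := filter_subseq _ _.
have sub00 : subseq Y00 y := subseq_trans (filter_subseq _ _) sub10.
have Uin z : subseq z y -> uniq ((- c)%R :: rcons z c).
  move=> sz; apply: subseq_uniq Ux; rewrite /= eqxx -!cats1; exact: cat_subseq.
have Ur z : subseq z y -> uniq (rcons z c) by move=> /Uin /andP [].
have Ul z : subseq z y -> uniq ((- c)%R :: z).
  by move=> /Uin; rewrite -rcons_cons rcons_uniq => /andP [].
have Uz z : subseq z y -> uniq z by move=> /Ul /andP [].
have M10 : (- Posz M)%R \in Y10 by rewrite mem_filter /= nMy andbT; clear -M0; lia.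
have M01 : Posz M \in Y01 by rewrite mem_filter /= My andbT; clear -M0; lia.
have cb : (- Posz M <= c <= Posz M)%R by clear -cM; lia.
have ncb : (- Posz M <= - c <= Posz M)%R by clear -cM; lia.
have bdz z : subseq z y -> forall a, a \in (- c)%R :: rcons z c -> (- Posz M <= a <= Posz M)%R.
  move=> /mem_subseq sz a; rewrite inE mem_rcons inE => /or3P [/eqP ->|/eqP ->|/sz] //.
  exact: yM.
have lo z : subseq z y -> all (fun a => - Posz M <= a)%R ((- c)%R :: rcons z c).
  by move=> sz; apply/allP => a az; have /andP [] := bdz z sz a az.
have hi z : subseq z y -> all (fun a => a <= Posz M)%R ((- c)%R :: rcons z c).
  by move=> sz; apply/allP => a az; have /andP [] := bdz z sz a az.
have lor z : subseq z y -> all (fun a => - Posz M <= a)%R (rcons z c).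
  by move=> /lo /= /andP [].
have hir z : subseq z y -> all (fun a => a <= Posz M)%R (rcons z c).
  by move=> /hi /= /andP [].
have suby := subseq_refl y.
have star_r z : star (rcons z c) = (- c)%R :: star z.
  by rewrite -cats1 star_cat.
have star_l z : star ((- c)%R :: z) = rcons (star z) c by rewrite star_cons opprK.
(* Prepending [-c] to the mirrored word has the same effect on the shape as appending [c] to the
   word itself. *)
have dl z : subseq z y -> diagram ((- c)%R :: star z) =1 diagram (rcons z c).
  by move=> sz; rewrite -star_r; apply: diagram_star; apply: Ur.
apply: (@cubeP _ (diagram (rcons Y00 c)) (diagram Y01) (diagram (rcons Y01 c))
   (diagram (rcons Y10 c)) _ _ (diagram ((- c)%R :: rcons Y10 c)) (diagram (rcons y c)));
  try by apply: diagram_ideal; rewrite ?Uin ?Ur ?Uz.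
- by rewrite -e00; apply: row_square_last_max; rewrite ?Ur ?hir.
- have H := col_square_last_min (Ur _ sub10) M10 (lor _ sub10).
  by apply: eq_col_square H => // a; rewrite -s10 diagram_star // Uz.
- have mem : (- Posz M)%R \in (- c)%R :: Y10 by rewrite inE M10 orbT.
  have H := @col_square_last_min ((- c)%R :: Y10) c _ (Uin _ sub10) mem (lo _ sub10).
  have e : remove (- Posz M)%R ((- c)%R :: Y10) = (- c)%R :: Y00 by rewrite /= ncMz'.
  rewrite e in H.
  by apply: eq_col_square H => // a; [rewrite -[in LHS]s00 dl|rewrite -[in LHS]s01 dl].
- have mem : (- Posz M)%R \in rcons Y10 c by rewrite mem_rcons inE M10 orbT.
  have H := row_square_first_min (Uin _ sub10) mem (lo _ sub10).
  have e : remove (- Posz M)%R (rcons Y10 c) = rcons Y00 c by rewrite filter_rcons /= cMz'.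
  by rewrite e in H.
- have H := row_square_last_max (Ur _ suby) My (hir _ suby).
  by apply: eq_row_square H => // a; rewrite -s10 diagram_star // Uz.
- by apply: col_square_last_min; rewrite ?Ur ?lor.
- have mem : Posz M \in (- c)%R :: y by rewrite inE My orbT.
  have H := @row_square_last_max ((- c)%R :: y) c _ (Uin _ suby) mem (hi _ suby).
  have e : remove (Posz M) ((- c)%R :: y) = (- c)%R :: Y10 by rewrite /= ncMz.
  rewrite e in H.
  by apply: eq_row_square H => // a; [rewrite -[in LHS]s01 dl|rewrite -[in LHS]sy dl].
- have mem : (- Posz M)%R \in (- c)%R :: y by rewrite inE nMy orbT.
  have H := @col_square_last_min ((- c)%R :: y) c _ (Uin _ suby) mem (lo _ suby).
  have e : remove (- Posz M)%R ((- c)%R :: y) = (- c)%R :: Y01 by rewrite /= ncMz'.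
  rewrite e in H.
  apply: eq_col_square H => // a.
  + by rewrite -[in LHS]s10 dl.
  + by rewrite -[in RHS]diagram_star ?Uin // star_l star_r s10.
  + by rewrite -[in LHS]sy dl.
Qed.

Lemma row_len_rcons_max y M k : all (fun a => a < M)%R y ->
  row_len (rcons y M) k = row_len y k + (k == 0).
Proof.
by move=> yM; rewrite !row_lenE RS_rcons tab_insert_max ?size_append_at // (perm_all _ (RS_perm y)).
Qed.

(** The letter [c] is last and largest, [-c] first and smallest: each lengthens the first row by
    one, as [star] shows for [-c]. *)
Lemma minus_vec_max w c : signed_word (rcons w c) -> all (fun a => `|a|%N < `|c|%N) w ->
  (0 < c)%R ->
  exists r, add_cells [:: (0, r); (0, r.+1)] (diagram (minus_vec w)) (diagram (minus_vec (rcons w c))).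
Proof.
move=> sw wc c0; have Ux := minus_vec_uniq sw; rewrite minus_vec_rcons in Ux *.
set y := minus_vec w in Ux *.
have yc : all (fun a => a < c)%R y.
  apply/allP => a; rewrite mem_minus_vec => /mapP [b /(allP wc)].
  by clear -c0; lia.
have nyc : all (fun a => a < c)%R ((- c)%R :: y).
  by rewrite /= yc andbT; clear -c0; lia.
have el k : row_len ((- c)%R :: y) k = row_len (rcons y c) k.
  rewrite -[y in LHS]star_minus_vec -[(- c)%R :: _]/(star [:: c] ++ star y) -star_cat cats1.
  by apply: row_len_star; case/andP: Ux.
exists (row_len y 0).
apply: (@add_cells_rcons [:: _] _ _ (diagram (rcons y c))).
  by apply/add_cells1/add_cell_row => k; apply: row_len_rcons_max.
have -> : (row_len y 0).+1 = row_len (rcons y c) 0 by rewrite row_len_rcons_max // addn1.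
by apply: add_cell_row => k; rewrite -el; apply: (row_len_rcons_max (y := _ :: _)).
Qed.

Lemma add_cells_swap l A B : add_cells l A B ->
  add_cells (map swap l) (A \o swap) (B \o swap).
Proof.
case=> U N H; split=> [||c].
- by rewrite map_inj_uniq //; apply: can_inj swapK.
- by rewrite all_map; apply: sub_all N => c /=; rewrite swapK.
- rewrite /= H; congr (_ || _); rewrite -[c in RHS]swapK mem_map //; exact: can_inj swapK.
Qed.

Lemma eq_add_cells l A B A' B' : A =1 A' -> B =1 B' -> add_cells l A B -> add_cells l A' B'.
Proof.
move=> eA eB [U N H]; split=> [//||c]; last by rewrite -eA -eB.
by apply: sub_all N => c; rewrite eA.
Qed.

Lemma minus_vec_opp w : minus_vec [seq - a | a <- w]%R = [seq - a | a <- minus_vec w]%R.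
Proof. by rewrite /minus_vec map_cat -map_rev. Qed.

Lemma signed_word_oppr w : signed_word [seq - a | a <- w]%R = signed_word w.
Proof.
rewrite /signed_word -map_comp; congr (uniq _ && ~~ _).
  by apply: eq_map => a /=; rewrite abszN.
by rewrite -[0%R in LHS]oppr0 mem_map //; apply: oppr_inj.
Qed.

(** The transpose of [minus_vec_max], obtained by negating the word. *)
Lemma minus_vec_min w c : signed_word (rcons w c) -> all (fun a => `|a|%N < `|c|%N) w ->
  (c < 0)%R ->
  exists r, add_cells [:: (r, 0); (r.+1, 0)] (diagram (minus_vec w)) (diagram (minus_vec (rcons w c))).
Proof.
move=> sw wc c0; have sw' : signed_word w by move: sw; rewrite signed_word_rcons => /and3P [].
have := @minus_vec_max [seq - a | a <- w]%R (- c)%R.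
rewrite -map_rcons signed_word_oppr => /(_ sw) H.
case: H.
- by rewrite all_map; apply: sub_all wc => a /=; rewrite !abszN.
- by rewrite oppr_gt0.
move=> r /add_cells_swap /= H; exists r; apply: eq_add_cells H => -[i j] /=;
by rewrite minus_vec_opp diagram_opp // minus_vec_uniq.
Qed.

(** * Changing the sign of the letter of smallest absolute value *)

Definition flip (m : nat) (a : int) : int := if `|a|%N == m then (- a)%R else a.

Lemma absz_flip m a : `|flip m a|%N = `|a|%N.
Proof. by rewrite /flip; case: ifP; rewrite ?abszN. Qed.

Lemma flipK m : involutive (flip m).
Proof. by move=> a; rewrite /flip; case E: (`|a|%N == m); rewrite ?abszN E ?opprK. Qed.

Lemma flipN m a : flip m (- a)%R = (- flip m a)%R.
Proof. by rewrite /flip abszN; case: ifP. Qed.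

Lemma abs_flip m w : [seq `|a|%N | a <- map (flip m) w] = [seq `|a|%N | a <- w].
Proof. by rewrite -map_comp; apply: eq_map => a /=; rewrite absz_flip. Qed.

Lemma signed_word_flip m w : signed_word (map (flip m) w) = signed_word w.
Proof.
rewrite /signed_word abs_flip; congr (_ && ~~ _).
have e : flip m 0%R = 0%R by rewrite /flip; case: ifP; rewrite ?oppr0.
by rewrite -{1}e mem_map //; apply: can_inj (flipK m).
Qed.

Lemma minus_vec_flip m w : minus_vec (map (flip m) w) = map (flip m) (minus_vec w).
Proof.
rewrite /minus_vec map_cat -map_rev -!map_comp; congr (_ ++ _).
by apply: eq_map => a /=; rewrite flipN.
Qed.

(** For distinct letters this is, by Greene's theorem, the largest number of letters in [k] disjoint
    increasing subsequences. *)
Definition row_sum (x : seq int) (k : nat) : nat := \sum_(i < k) row_len x i.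

Lemma row_sum_flip_le1 m w k : signed_word w -> all (fun a => m <= `|a|%N) w ->
  row_sum (minus_vec w) k <= (row_sum (minus_vec (map (flip m) w)) k).+1.
Proof.
move=> sw wm; have Ux := minus_vec_uniq sw.
have Uf : uniq (minus_vec (map (flip m) w)).
  by rewrite minus_vec_uniq // signed_word_flip.
set x := minus_vec w in Ux *.
have xm a : a \in x -> m <= `|a|%N.
  by rewrite mem_minus_vec => /mapP [b bw ->]; apply: (allP wm).
suff : greene k (minus_vec (map (flip m) w)) (row_sum x k).-1.
  by move/(greene_theorem _ _ Uf); rewrite -/(row_sum _ k); clear; lia.
have [col P C] := (greene_theorem k (row_sum x k) Ux).2 (leqnn _).
rewrite minus_vec_flip -/x.
(* The letter [m] of the flipped word is discarded; it comes from [-m] in [x], whose multiplicity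
   bounds the loss. *)
exists (fun a => if a == Posz m then k else col (flip m a)).
  rewrite pairwise_map; apply: (sub_in_pairwise (P := mem x)) P; last by apply/allP.
  move=> a b /xm ax /xm bx /color_ltP H; apply/color_ltP; rewrite !flipK.
  have [ea|ea] := eqVneq; first by rewrite ltnn.
  have [eb|eb] := eqVneq; first by move=> ->; rewrite ltnn.
  move=> e l; have := H e l; move: ea eb ax bx; rewrite /flip; clear.
  by do 2 case: ifP; lia.
rewrite count_map.
have H : count (fun a => col a < k) x <=
   count (preim (flip m) (fun a => (if a == Posz m then k else col (flip m a)) < k)) x + count_mem (- Posz m)%R x.
  rewrite -count_predUI; apply: leq_trans (leq_addr _ _); apply: sub_count => a /= ak.
  rewrite flipK; case: eqP => [e|_]; last by rewrite ak.
  by rewrite ltnn -[a](flipK m) e /flip eqxx eqxx.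
have := count_uniq_mem (- Posz m)%R Ux; move: C H; clear; by case: (_ \in _); lia.
Qed.

(** Since [m] is in [w], the doubled word has [-m] before [m]. Undoing the flip makes this pair
    increasing and keeps all other comparisons, so colorings of the flipped word remain valid. *)
Lemma row_sum_flip_le m w k : signed_word w -> all (fun a => m <= `|a|%N) w ->
  Posz m \in w ->
  row_sum (minus_vec (map (flip m) w)) k <= row_sum (minus_vec w) k.
Proof.
move=> sw wm mw; have Ux := minus_vec_uniq sw.
have Uf : uniq (minus_vec (map (flip m) w)).
  by rewrite minus_vec_uniq // signed_word_flip.
set x := minus_vec w in Ux *.
have xm a : a \in x -> m <= `|a|%N.
  by rewrite mem_minus_vec => /mapP [b bw ->]; apply: (allP wm).
have nmw : (- Posz m)%R \notin w by apply/negP; apply: signed_word_opp mw.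
have ord : pairwise (fun a b => ~~ ((a == Posz m) && (b == - Posz m)%R)) x.
  have nw (z : seq int) : (- Posz m)%R \notin z ->
      pairwise (fun a b => ~~ ((a == Posz m) && (b == - Posz m)%R)) z.
    move=> Hz; apply/(pairwiseP 0%R) => i j; rewrite !inE => iz jz _.
    by apply/negP => /andP [_ /eqP e]; rewrite -e mem_nth in Hz.
  rewrite /x minus_vecE pairwise_cat; apply/and3P; split; last exact: nw.
    apply/allrelP => a b _ bw; apply/negP => /andP [_ /eqP e].
    by rewrite -e bw in nmw.
  have ns : Posz m \notin star w by rewrite mem_star.
  apply/(pairwiseP 0%R) => i j; rewrite !inE => iz jz _.
  by apply/negP => /andP [/eqP e _]; rewrite -e mem_nth in ns.
apply/(greene_theorem _ _ Ux).
have [col P C] := (greene_theorem k (row_sum _ k) Uf).2 (leqnn _).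
exists (fun a => col (flip m a)); last by move: C; rewrite [X in _ <= count _ X -> _]minus_vec_flip count_map.
move: P; rewrite minus_vec_flip pairwise_map -/x => P.
have := pairwise_relI (relpre (flip m) (color_lt k col)) (fun a b => ~~ ((a == Posz m) && (b == - Posz m)%R)) x.
rewrite P ord => H; move: H => /=.
apply: (sub_in_pairwise (P := mem x)); last by apply/allP.
move=> a b /xm ax /xm bx /= /andP [/color_ltP H ne]; apply/color_ltP => e l.
have := H e l; move: ne ax bx; rewrite /flip; clear; do 2 case: ifP; lia.
Qed.

(** The sign of the letter of absolute value [m] in [w'] decides the direction. The word [w] either
    contains the same letter or is fixed by the flip, so the direction is common to both. *)
Lemma row_sum_flip m w w' : signed_word w' -> all (fun a => m <= `|a|%N) w' ->
  {subset w <= w'} -> signed_word w ->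
  (forall k, row_sum (minus_vec (map (flip m) w)) k <= row_sum (minus_vec w) k /\
             row_sum (minus_vec (map (flip m) w')) k <= row_sum (minus_vec w') k) \/
  (forall k, row_sum (minus_vec w) k <= row_sum (minus_vec (map (flip m) w)) k /\
             row_sum (minus_vec w') k <= row_sum (minus_vec (map (flip m) w')) k).
Proof.
move=> sw' wm' ss sw.
have wm : all (fun a => m <= `|a|%N) w by apply/allP => a /ss /(allP wm').
have none z : Posz m \notin z -> (- Posz m)%R \notin z -> map (flip m) z = z.
  move=> h1 h2; apply: map_id_in => a az; rewrite /flip; case: eqP => // e.
  have [ea|ea] : a = Posz m \/ a = (- Posz m)%R by clear -e; lia.
    by rewrite ea in az; rewrite az in h1.
  by rewrite ea in az; rewrite az in h2.
have pos z k : {subset z <= w'} -> signed_word z -> (- Posz m)%R \notin w' ->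
   row_sum (minus_vec (map (flip m) z)) k <= row_sum (minus_vec z) k.
  move=> zw sz nm; have zm : all (fun a => m <= `|a|%N) z by apply/allP => a /zw /(allP wm').
  have [mz|mz] := boolP (Posz m \in z); first exact: row_sum_flip_le.
  by rewrite none //; apply: contra nm; apply: zw.
have neg z k : {subset z <= w'} -> signed_word z -> (- Posz m)%R \in w' ->
   row_sum (minus_vec z) k <= row_sum (minus_vec (map (flip m) z)) k.
  move=> zw sz nm; have zm : all (fun a => m <= `|a|%N) z by apply/allP => a /zw /(allP wm').
  have [mz|mz] := boolP ((- Posz m)%R \in z); last first.
    rewrite none //; apply/negP => /zw H.
    exact: (signed_word_opp sw' H nm).
  have -> : minus_vec z = minus_vec (map (flip m) (map (flip m) z)).
    by rewrite -map_comp map_id_in // => a _ /=; apply: flipK.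
  apply: row_sum_flip_le; first by rewrite signed_word_flip.
    by rewrite all_map; apply: sub_all zm => a /=; rewrite absz_flip.
  have <- : flip m (- Posz m)%R = Posz m by rewrite /flip abszN /= eqxx opprK.
  exact: map_f.
have [nm|nm] := boolP ((- Posz m)%R \in w').
  by right=> k; split; apply: neg.
by left=> k; split; apply: pos.
Qed.

(** * Even cells *)

(** Counting rows and columns from 0 instead of 1 does not change the parity of their sum. *)
Definition even_cell (c : nat * nat) : bool := ~~ odd (c.1 + c.2).

Definition same_even (A B : nat * nat -> bool) : Prop := forall c, even_cell c -> A c = B c.

Definition add_even (e : nat * nat) (A B : nat * nat -> bool) : Prop :=
  [/\ even_cell e, ~~ A e & forall c, even_cell c -> B c = A c || (c == e)].

Lemma even_cell_swap c : even_cell (swap c) = even_cell c.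
Proof. by rewrite /even_cell addnC. Qed.

Lemma same_even_sym A B : same_even A B -> same_even B A.
Proof. by move=> H c /H. Qed.

Lemma same_even_swap A B : same_even A B -> same_even (A \o swap) (B \o swap).
Proof. by move=> H c ec; apply: H; rewrite even_cell_swap. Qed.

Lemma ideal_swap A : ideal A -> ideal (A \o swap).
Proof. by move=> iA i j i' j' ii jj; apply: iA. Qed.

Lemma add_even_swap e A B : add_even e A B -> add_even (swap e) (A \o swap) (B \o swap).
Proof.
case=> ee eA H; split; rewrite /= ?even_cell_swap ?swapK // => c ec.
rewrite H ?even_cell_swap //; congr (_ || _).
by apply/eqP/eqP => [<-|->]; rewrite swapK.
Qed.

Lemma add_even_parity a b A B : add_cells [:: a; b] A B ->
  (exists e, add_even e A B) <-> even_cell a != even_cell b.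
Proof.
case; rewrite /= inE !andbT => ab /andP [Aa Ab] H; split.
  case=> e [ee eA He].
  case ea: (even_cell a); case eb: (even_cell b) => //.
    have := He a ea; have := He b eb; rewrite !H !inE (negbTE Aa) (negbTE Ab) !eqxx orbT /=.
    by move=> /esym /eqP e1 /esym /eqP e2; rewrite e1 e2 eqxx in ab.
  have := He e ee; rewrite H (negbTE eA) eqxx /= !inE => /orP [] /eqP e1.
    by rewrite e1 ea in ee.
  by rewrite e1 eb in ee.
case ea: (even_cell a); case eb: (even_cell b) => // _; [exists a|exists b]; split=> // c ec;
  rewrite H !inE; congr (_ || _).
  by case: (c =P b) => [e|_]; [rewrite e eb in ec|rewrite orbF].
by case: (c =P a) => [e|_]; [rewrite e ea in ec|].
Qed.

Lemma add_cells_diff l1 l2 l A B C : add_cells l A C -> add_cells l1 A B ->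
  perm_eq l (l1 ++ l2) -> add_cells l2 B C.
Proof.
case=> U N H [U1 N1 H1] P; move: U; rewrite (perm_uniq P) cat_uniq => /and3P [_ /hasPn d U2].
split=> // [|c]; last by rewrite H H1 (perm_mem P) mem_cat orbA.
apply/allP => c c2; rewrite H1 negb_or d // andbT.
by apply: (allP N); rewrite (perm_mem P) mem_cat c2 orbT.
Qed.

Lemma add_cells_perm l l' A B : perm_eq l l' -> add_cells l A B -> add_cells l' A B.
Proof.
move=> P [U N H]; split; first by rewrite -(perm_uniq P).
  by rewrite -(perm_all _ P).
by move=> c; rewrite H (perm_mem P).
Qed.

(** The two cells of [Ro] missing from [Mu] form a domino, [t], [z] or [s], [z], so their parities
    differ. *)
Lemma bump_parity L Mu Ro p s t z :
  s.1 = p.1.+1 -> t.2 = p.2.+1 -> z = (t.1.+1, s.2.+1) ->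
  add_cells [:: p; s; t; z] L Ro ->
  (add_cells [:: p; s] L Mu /\ s.2 = p.2) \/ (add_cells [:: p; t] L Mu /\ t.1 = p.1) ->
  exists e, add_even e Mu Ro.
Proof.
move=> es et ez LR [[LM e]|[LM e]].
  apply/(add_even_parity (a := t) (b := z)); first by apply: add_cells_diff LR LM _.
  by rewrite ez /even_cell /= et e; clear; lia.
apply/(add_even_parity (a := s) (b := z)).
  by apply: add_cells_diff LR LM _; apply/permP => f /=; clear; lia.
by rewrite ez /even_cell /= es e; clear; lia.
Qed.

(** In the disjoint case opposite sides of the cube add the same pair of cells; in the bump case the
    added pairs are dominoes. *)
Lemma cube_add_even L Mu Nu Ro : cube_spec L Mu Nu Ro ->
  (exists e, add_even e L Mu) -> (exists e, add_even e L Nu) ->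
  (exists e, add_even e Mu Ro) /\ (exists e, add_even e Nu Ro).
Proof.
case=> [p p2 q q2 LM LN LR eM eN|p s t z B N P es et ez LR LB BP BN iP iN HM HN _ _].
  split.
    apply/(add_even_parity (a := q) (b := q2)); last exact/(add_even_parity LN).
    exact: add_cells_diff LR LM _.
  apply/(add_even_parity (a := p) (b := p2)); last exact/(add_even_parity LM).
  apply: add_cells_diff LR LN _; apply/permP => f /=; clear; lia.
by split; apply: bump_parity LR _.
Qed.

Lemma cube_subset L Mu Nu Ro c : cube_spec L Mu Nu Ro -> Mu c -> Ro c.
Proof.
case=> [p p2 q q2 [_ _ LM] _ [_ _ LR]|p s t z B N P _ _ _ [_ _ LR] _ _ _ _ _ HM _].
  by rewrite LM LR !inE => /orP [->|/orP [] ->]; rewrite ?orbT.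
by case: HM => -[[_ _ LM] _]; rewrite LM LR !inE => /orP [->|/orP [] ->]; rewrite ?orbT.
Qed.

(* The vertical bump: p and the cell below it are added, and they push a
   vertical domino with top cell t into the next column. *)
Definition vertical_bump (L Ro : nat * nat -> bool) (e : nat * nat) : Prop :=
  exists p t e',
  [/\ add_cells [:: p; (p.1.+1, p.2); t; (t.1.+1, t.2)] L Ro,
      [/\ t.2 = p.2.+1, t.1 <= p.1 & (t.1 = 0 \/ L (t.1.-1, t.2))],
      e = p \/ e = (p.1.+1, p.2),
      e' = t \/ e' = (t.1.+1, t.2) &
      [/\ even_cell e, even_cell e' &
          forall c, even_cell c -> Ro c = [|| L c, c == e | c == e']]].

Definition horizontal_bump (L Ro : nat * nat -> bool) (e : nat * nat) : Prop :=
  vertical_bump (L \o swap) (Ro \o swap) (swap e).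

(** The position of [t] is read off from the ideal [N], which is [L] with [p] and [t] added: it
    contains the cell of column [p.2] left of [t] and the cell above [t]. *)
Lemma bump_vertical L Mu Ro B N p s t z e : ideal L -> ideal N ->
  s.1 = p.1.+1 -> t.2 = p.2.+1 -> z = (t.1.+1, s.2.+1) ->
  add_cells [:: p; s; t; z] L Ro -> add_cell p L B -> add_cell t B N ->
  add_cells [:: p; s] L Mu -> s.2 = p.2 -> add_even e L Mu -> vertical_bump L Ro e.
Proof.
move=> iL iN es et ez LR [Lp LB] [Bt BN] LM es2 [ee eL eM].
have sE : s = (p.1.+1, p.2) by rewrite [s]surjective_pairing es es2.
have zE : z = (t.1.+1, t.2) by rewrite ez es2 et.
clear ez; subst s z; have [UR NR HR] := LR; have [UM NM HM] := LM.
have Nt : N (t.1, t.2) by rewrite BN -surjective_pairing eqxx orbT.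
have ltp : t.1 <= p.1.
  have : N (t.1, p.2) by apply: iN Nt; rewrite ?et.
  rewrite BN LB => /orP [/orP [Lt|/eqP <-//]|/eqP e1]; last first.
    by move: et; rewrite -e1 /=; clear; lia.
  rewrite leqNgt; apply/negP => lt; move/negP: Lp; apply.
  by rewrite [p]surjective_pairing; apply: iL Lt => //; apply: ltnW.
have up : t.1 = 0 \/ L (t.1.-1, t.2).
  case: (posnP t.1) => [->|t0]; [by left|right].
  have : N (t.1.-1, t.2) by apply: iN Nt; rewrite ?leq_pred.
  rewrite BN LB => /orP [/orP [//|/eqP e1]|/eqP e1].
    by move: et; rewrite -e1 /=; clear; lia.
  by move: t0 (congr1 fst e1) => /=; clear; lia.
have He : e = p \/ e = (p.1.+1, p.2).
  have := eM e ee; rewrite HM (negbTE eL) eqxx /= !inE => /orP [] /eqP ->; by [left|right].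
have [e' [He' ee' ne']] : exists e', [/\ e' = t \/ e' = (t.1.+1, t.2), even_cell e' &
    forall c, (c == t) || (c == (t.1.+1, t.2)) -> even_cell c -> c = e'].
  case et': (even_cell t); [exists t|exists (t.1.+1, t.2)]; split; auto.
  - move=> c /orP [/eqP //|/eqP ->]; move: et'; rewrite /even_cell /=; clear; lia.
  - by move: et'; rewrite /even_cell /=; clear; lia.
  - by move=> c /orP [/eqP -> |/eqP //]; rewrite et'.
exists p, t, e'; split=> //; split=> // c ec.
have := eM c ec; rewrite HR HM !inE.
case Lc: (L c) => //=; rewrite orbA => ->; congr (_ || _).
apply/idP/eqP => [h|->]; first exact: ne'.
by case: He' => ->; rewrite eqxx ?orbT.
Qed.

(** Disjoint pairs cannot share the even cell [e], so there is a bump, and the domino of [Mu] gives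
    its direction. *)
Lemma cube_bump L Mu Nu Ro e : ideal L -> cube_spec L Mu Nu Ro ->
  add_even e L Mu -> add_even e L Nu -> vertical_bump L Ro e \/ horizontal_bump L Ro e.
Proof.
move=> iL C eM eN; case: C => [p p2 q q2 LM LN [U _ _]|p s t z B N P es et ez LR LB BP BN iP iN HM _].
  case: eM => ee eL eM; case: eN => _ _ eN; case: LM => _ _ LM; case: LN => _ _ LN.
  have := eM e ee; rewrite LM (negbTE eL) eqxx /= => e1.
  have := eN e ee; rewrite LN (negbTE eL) eqxx /= => e2.
  have : uniq ([:: p; p2] ++ [:: q; q2]) by [].
  by rewrite cat_uniq => /and3P [_ /hasPn /(_ _ e2)]; rewrite e1.
case: HM => -[LM e0].
  by left; apply: bump_vertical LR LB BN LM e0 eM.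
right; apply: (@bump_vertical _ (Mu \o swap) _ (B \o swap) (P \o swap) (swap p) (swap t) (swap s) (swap z)) => //.
- exact: ideal_swap.
- exact: ideal_swap.
- by rewrite ez.
- have := add_cells_swap LR; apply: add_cells_perm; apply/permP => f /=; clear; lia.
- exact: add_cell_swap.
- exact: add_cell_swap.
- exact: (add_cells_swap LM).
- exact: add_even_swap.
Qed.

(** The pushed domino contributes the first even cell of its column missing from [L]; thus the even
    cells of [L], together with [e], determine those of [Ro]. *)
Lemma vertical_bump_first L Ro e : ideal L -> vertical_bump L Ro e ->
  exists2 h, (forall c, even_cell c -> Ro c = [|| L c, c == e | c == (h, e.2.+1)]) /\
             even_cell (h, e.2.+1) &
    forall i, even_cell (i, e.2.+1) -> L (i, e.2.+1) = (i < h).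
Proof.
move=> iL [p [t [e' [LR [et ltp up] He He' [ee ee' HR]]]]].
have [_ NR _] := LR.
have e2 : e'.2 = e.2.+1 by case: He He' => -> [] ->; rewrite /= et.
have eE : e' = (e'.1, e.2.+1) by rewrite [e' in LHS]surjective_pairing e2.
exists e'.1; first by rewrite -eE.
move=> i ei; apply/idP/idP => [Li|lt_i].
  rewrite ltnNge; apply/negP => le_i.
  have : L e' by rewrite eE; apply: iL Li.
  apply/negP; apply: (allP NR); rewrite !inE.
  by case: He' => ->; rewrite eqxx ?orbT.
have te : t.2 = e.2.+1 by case: He' => e1; rewrite -e2 e1.
(* If [e'] is the lower cell of the pushed domino, parity excludes [i = t.1]. *)
have lt_it : i < t.1.
  case: He' => e1; first by rewrite -e1.
  move: lt_i ee'; rewrite e1 /= => lt_i; move: ei lt_i; rewrite /even_cell /= te; clear; lia.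
by case: up => [e0|Lt]; [rewrite e0 in lt_it|apply: iL Lt; rewrite ?te //; move: lt_it; clear; lia].
Qed.

Lemma vertical_bump_same L Ro L' Ro' e : ideal L -> ideal L' -> same_even L L' ->
  vertical_bump L Ro e -> vertical_bump L' Ro' e -> same_even Ro Ro'.
Proof.
move=> iL iL' LL /(vertical_bump_first iL) [h [HR eh] Hh].
move=> /(vertical_bump_first iL') [h' [HR' eh'] Hh'] c ec.
suff e1 : h = h' by rewrite HR // HR' // LL // e1.
have := Hh _ eh; have := Hh' _ eh'; have := Hh _ eh'; have := Hh' _ eh.
by rewrite -!LL //; do 2 case: (L _) => //; rewrite !ltnn; case: ltngtP.
Qed.

Lemma horizontal_bump_same L Ro L' Ro' e : ideal L -> ideal L' -> same_even L L' ->
  horizontal_bump L Ro e -> horizontal_bump L' Ro' e -> same_even Ro Ro'.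
Proof.
move=> iL iL' LL H H' c ec.
have := vertical_bump_same (ideal_swap iL) (ideal_swap iL') (same_even_swap LL) H H'.
by move/(_ (swap c)); rewrite even_cell_swap /= swapK; apply.
Qed.

(** The row of the second even cell is at most [e.1.+1] because [L] lacks [e], exceeds [e.1.-1]
    unless [e] is in the first row, and has the parity of [e.1.+1]. *)
Lemma vertical_bump_corner L Ro e : ideal L -> ~~ L e -> vertical_bump L Ro e ->
  even_cell e -> (e.1 = 0 \/ L (e.1.-1, e.2.+1)) ->
  forall c, even_cell c -> Ro c = [|| L c, c == e | c == (e.1.+1, e.2.+1)].
Proof.
move=> iL Le /(vertical_bump_first iL) [h [HR eh] Hh] ee b c ec.
suff <- : h = e.1.+1 by apply: HR.
have ev : even_cell (e.1.+1, e.2.+1) by move: ee; rewrite /even_cell /=; clear; lia.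
have h1 : h <= e.1.+1.
  rewrite leqNgt -(Hh _ ev); apply: contra Le.
  by rewrite [e in X in _ -> X]surjective_pairing; apply: iL; rewrite leqnSn.
case: b => [e0|Lb].
  by move: h1 eh ee; rewrite /even_cell /= e0; clear; lia.
case: (posnP e.1) => [e0|e0]; first by move: h1 eh ee; rewrite /even_cell /= e0; clear; lia.
have ev' : even_cell (e.1.-1, e.2.+1) by move: ee e0; rewrite /even_cell /=; clear; lia.
by have := Hh _ ev'; rewrite Lb => /esym; move: h1 eh ee e0; rewrite /even_cell /=; clear; lia.
Qed.

(** The left neighbour of the lower cell of the first domino lies in [Ro], in a column that receives
    no new cell. *)
Lemma vertical_bump_left L Ro p t : ideal Ro ->
  add_cells [:: p; (p.1.+1, p.2); t; (t.1.+1, t.2)] L Ro -> t.2 = p.2.+1 ->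
  p.2 = 0 \/ L (p.1.+1, p.2.-1).
Proof.
move=> iR [_ _ HR] et; case: (posnP p.2) => [|p0]; [by left|right].
have : Ro (p.1.+1, p.2.-1).
  apply: (iR p.1.+1 p.2); rewrite ?leq_pred //.
  by rewrite HR !inE eqxx !orbT.
rewrite HR !inE; case/orP => [//|] /or4P [] /eqP /(congr1 snd) /=; rewrite ?et; move: p0; clear; lia.
Qed.

(** The cases are the places of [e] in the two first dominoes. One gives the same even cells, two
    are impossible, and the last contradicts the cell count. *)
Lemma vertical_horizontal_bump L Ro L' Ro' e :
  ideal L -> ideal L' -> ideal Ro -> ideal Ro' -> same_even L L' ->
  (forall k l l', add_cells l L Ro -> add_cells l' L' Ro' ->
     count (fun c => c.1 < k) l' < count (fun c => c.1 < k) l + 2) ->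
  horizontal_bump L Ro e -> vertical_bump L' Ro' e -> ~~ L e -> same_even Ro Ro'.
Proof.
move=> iL iL' iR iR' LL Hcount HH VV Le.
have [p [t [e' [LR [et ltp up] He He' [ee ee' HR]]]]] := HH.
have [q [u [f' [LR' [eu ltq vp] Hf Hf' [ef ef' HR']]]]] := VV.
have Le' : ~~ L' e by rewrite -LL.
have iLs := ideal_swap iL.
case: He => He; case: Hf => Hf.
(* Here [e] is a left cell and a top cell. Each bump supplies the corner hypothesis for the other,
   so both add the diagonal neighbour of [e]. *)
- have := vertical_bump_left (ideal_swap iR) LR et; rewrite -He /= => HL.
  have := vertical_bump_left iR' LR' eu; rewrite -Hf => HL'.
  have C1 : forall c, even_cell c -> Ro' c = [|| L' c, c == e | c == (e.1.+1, e.2.+1)].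
    apply: vertical_bump_corner => //.
    case: HL => [e0|Lb]; [by left|].
    case: (posnP e.1) => [|e0]; [by left|right].
    by rewrite -LL //; move: ef e0; rewrite /even_cell /=; clear; lia.
  have C2 : forall c, even_cell c -> (Ro \o swap) c = [|| (L \o swap) c, c == swap e | c == (e.2.+1, e.1.+1)].
    apply: (vertical_bump_corner iLs _ HH) => /=; rewrite ?even_cell_swap ?swapK //.
    case: HL' => [e0|Lb]; [by left|].
    case: (posnP e.2) => [|e0]; [by left|right].
    by rewrite /swap /= LL //; move: ef e0; rewrite /even_cell /=; clear; lia.
  move=> c ec; rewrite C1 // -LL // -[c in LHS]swapK.
  have := C2 (swap c); rewrite /= even_cell_swap => -> //; rewrite swapK.
  rewrite (inj_eq (can_inj swapK)); congr [|| _, _ | _].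
  by rewrite -[(e.2.+1, e.1.+1)]/(swap (e.1.+1, e.2.+1)) (inj_eq (can_inj swapK)).
(* Here [e] is a left cell and a bottom cell. Its upper right neighbour lies in [L], hence in [L'],
   which would put the new cell [q] into [L']. The next case is the transpose. *)
- have := vertical_bump_left (ideal_swap iR) LR et; rewrite -He /= => HL.
  have [_ NR' _] := LR'; have nq : ~~ L' q by apply: (allP NR'); rewrite inE eqxx.
  case: HL => [e0|Lb]; first by rewrite Hf in e0.
  case/negP: nq; have : L' (e.1.-1, e.2.+1).
    by rewrite -LL //; move: ef; rewrite Hf /even_cell /=; clear; lia.
  by rewrite Hf /= [q in X in _ -> X]surjective_pairing; apply: iL'.
- have := vertical_bump_left iR' LR' eu; rewrite -Hf => HL.
  have [_ NR _] := LR; have np : ~~ (L \o swap) p by apply: (allP NR); rewrite inE eqxx.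
  have eE : e = (p.2, p.1.+1) by rewrite -[e]swapK He.
  case: HL => [e0|Lb]; first by rewrite eE in e0.
  case/negP: np; have : L (e.1.+1, e.2.-1).
    by rewrite LL //; move: ef; rewrite eE /even_cell /=; clear; lia.
  by rewrite eE /=; apply: iL.
(* Here [e] is a right cell and a bottom cell. Above row [e.1] the vertical bump has at least the
   cells [q] and [u], the horizontal bump none. *)
- have eE : e = (p.2, p.1.+1) by rewrite -[e]swapK He.
  have LRs := add_cells_swap LR; rewrite /= in LRs.
  have LR2 : add_cells [:: swap p; swap (p.1.+1, p.2); swap t; swap (t.1.+1, t.2)] L Ro.
    by apply: eq_add_cells LRs => c /=; rewrite swapK.
  have := Hcount e.1 _ _ LR2 LR'.
  rewrite Hf in eE; case: eE => e1 e2; rewrite Hf /= et.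
  by move: ltq e1; clear; lia.
Qed.

(** The new cells of row [i] occupy exactly the columns from [row_len x i] up to, but excluding,
    [row_len y i]. *)
Lemma row_len_add_cells x y l i : add_cells l (diagram x) (diagram y) ->
  row_len y i = row_len x i + count (fun c => c.1 == i) l.
Proof.
case=> U N H; have le : row_len x i <= row_len y i.
  case: (posnP (row_len x i)) => [->//|x0].
  have : diagram y (i, (row_len x i).-1) by rewrite H /diagram /= prednK // leqnn.
  by rewrite /diagram /= prednK.
suff : perm_eq [seq c.2 | c <- l & c.1 == i] (iota (row_len x i) (row_len y i - row_len x i)).
  by move/perm_size; rewrite size_map size_filter size_iota => ->; rewrite subnKC.
apply: uniq_perm; rewrite ?iota_uniq //.
  rewrite map_inj_in_uniq ?filter_uniq // => -[a b] [c d]; rewrite !mem_filter /=.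
  by case/andP => /eqP -> _ /andP [/eqP -> _] ->.
move=> j; rewrite mem_iota subnKC //; apply/mapP/idP => [[c]|].
  rewrite mem_filter => /andP [/eqP ci cl] ->; rewrite -ci.
  have := H c; rewrite cl orbT /diagram => ->; rewrite andbT leqNgt.
  exact: (allP N c cl).
case/andP => xj jy; exists (i, j) => //; rewrite mem_filter eqxx /=.
by have := H (i, j); rewrite /diagram /= jy ltnNge xj.
Qed.

Lemma row_sum_add_cells x y l k : add_cells l (diagram x) (diagram y) ->
  row_sum y k = row_sum x k + count (fun c => c.1 < k) l.
Proof.
move=> H; rewrite /row_sum; elim: k => [|k IH].
  by rewrite !big_ord0 (@eq_count _ _ pred0) ?count_pred0.
rewrite !big_ord_recr /= IH (row_len_add_cells _ H).
suff -> : count (fun c : nat * nat => c.1 < k.+1) l =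
  count (fun c => c.1 < k) l + count (fun c => c.1 == k) l by rewrite addnACA.
rewrite -count_predUI [X in _ + X](@eq_count _ _ pred0) ?count_pred0 ?addn0.
  by apply: eq_count => c /=; rewrite ltnS leq_eqVlt orbC.
by move=> c /=; clear; lia.
Qed.

(** * The sign change *)

(** The even cells of the smaller shapes determine those of [Ro], except for bumps in different
    directions, where the bounds on the counts enter. *)
Lemma same_even_step L Mu Nu Ro L' Mu' Nu' Ro' :
  ideal L -> ideal L' -> ideal Ro -> ideal Ro' ->
  cube_spec L Mu Nu Ro -> cube_spec L' Mu' Nu' Ro' ->
  (exists e, add_even e L Mu) -> (exists e, add_even e L Nu) ->
  (exists e, add_even e L' Mu') -> (exists e, add_even e L' Nu') ->
  same_even L L' -> same_even Mu Mu' -> same_even Nu Nu' ->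
  (forall k l l', add_cells l L Ro -> add_cells l' L' Ro' ->
     count (fun c => c.1 < k) l' < count (fun c => c.1 < k) l + 2 /\
     count (fun c => c.1 < k) l < count (fun c => c.1 < k) l' + 2) ->
  same_even Ro Ro'.
Proof.
move=> iL iL' iR iR' C C' eM eN eM' eN' LL MM NN Hc.
have [_ [x NR]] := cube_add_even C eM eN; have [_ [x' NR']] := cube_add_even C' eM' eN'.
have tr e A B A' B' : same_even A A' -> same_even B B' -> add_even e A B -> add_even e A' B'.
  by move=> AA BB [h1 h2 h3]; split=> // [|c ec]; rewrite -?AA -?BB // h3.
case: eM => e LM; case: eN => g LN.
have LM' := tr _ _ _ _ _ LL MM LM; have LN' := tr _ _ _ _ _ LL NN LN.
have [eg|eg] := eqVneq e g.
  subst g; have Le : ~~ L e by case: LM.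
  have Le' : ~~ L' e by case: LM'.
  case: (cube_bump iL C LM LN) => T; case: (cube_bump iL' C' LM' LN') => T'.
  - exact: vertical_bump_same LL T T'.
  - apply/same_even_sym; apply: (vertical_horizontal_bump iL' iL iR' iR (same_even_sym LL) _ T' T Le').
    by move=> k l l' h h'; case: (Hc k l' l h' h).
  - apply: (vertical_horizontal_bump iL iL' iR iR' LL _ T T' Le).
    by move=> k l l' h h'; case: (Hc k l l' h h').
  - exact: horizontal_bump_same LL T T'.
(* With different even cells, [R] contains both [e] and [g]; as [N'] lacks [e], the last even cell
   [y] must be [e]. *)
have main A M N' R y : cube_spec A M N' R -> add_even e A M -> add_even g A N' ->
    add_even y N' R -> forall c, even_cell c -> R c = [|| A c, c == g | c == e].
  move=> CA [ee eA AM] [_ _ AN] [_ _ NR0] c ec.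
  have : R e by apply: cube_subset CA _; rewrite AM // eqxx orbT.
  rewrite NR0 // AN // (negbTE eA) (negbTE eg) /= => /eqP ey.
  by rewrite NR0 // AN // ey orbA.
move=> c ec; rewrite (main _ _ _ _ _ C LM LN NR) // (main _ _ _ _ _ C' LM' LN' NR') //.
by rewrite LL.
Qed.

Lemma exists_max_abs (w : seq int) : w != [::] ->
  exists2 M, M \in [seq `|a|%N | a <- w] & all (fun a => `|a|%N <= M) w.
Proof.
elim: w => // a [|b w] IH _; first by exists `|a|%N; rewrite /= ?inE ?eqxx ?leqnn.
have [M Mw wM] := IH isT.
have [le|lt] := leqP `|a|%N M.
  by exists M; [rewrite map_cons inE Mw orbT|rewrite [all _ _]/= le].
exists `|a|%N; first by rewrite map_cons inE eqxx.
rewrite [all _ _]/= leqnn; apply: sub_all wM => c /= cM; exact: leq_trans cM (ltnW lt).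
Qed.

Lemma small_rcons_ne M w c : `|c|%N != M -> small M (rcons w c) = rcons (small M w) c.
Proof. by rewrite /small filter_rcons => ->. Qed.

Lemma small_rcons_eq w c : signed_word (rcons w c) -> small `|c|%N (rcons w c) = w.
Proof.
rewrite signed_word_rcons => /and3P [_ cw _]; rewrite /small filter_rcons eqxx /=.
apply/all_filterP/allP => a aw; apply: contraNneq cw => <-; exact: map_f.
Qed.

Lemma size_small M w : M \in [seq `|a|%N | a <- w] -> size (small M w) < size w.
Proof.
case/mapP => a aw ->; rewrite size_filter -(count_predC (fun b => `|b|%N != `|a|%N) w).
rewrite -[X in X < _]addn0 ltn_add2l -has_count; apply/hasP; exists a => //=.
by rewrite eqxx.
Qed.

Lemma all_lt_last w c : signed_word (rcons w c) ->
  all (fun a => `|a|%N <= `|c|%N) (rcons w c) -> all (fun a => `|a|%N < `|c|%N) w.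
Proof.
rewrite signed_word_rcons all_rcons => /and3P [_ cw _] /andP [_ wc].
apply/allP => a aw; rewrite ltn_neqAle (allP wc a aw) andbT.
by apply: contraNneq cw => <-; apply: map_f.
Qed.

Lemma small_cube_hyps w c M : signed_word (rcons w c) ->
  M \in [seq `|a|%N | a <- rcons w c] -> all (fun a => `|a|%N <= M) (rcons w c) ->
  `|c|%N != M ->
  [/\ M \in [seq `|a|%N | a <- w], signed_word w, signed_word (small M w) &
      signed_word (rcons (small M w) c)].
Proof.
move=> sw Mw wM ne; have sw' : signed_word w by move: sw; rewrite signed_word_rcons => /and3P [].
split=> //.
- by move: Mw; rewrite map_rcons mem_rcons inE eq_sym (negbTE ne).
- exact: signed_word_filter.
- by rewrite -small_rcons_ne //; apply: signed_word_filter.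
Qed.

(** Both removals are treated together: the cube needs the first statement for [rcons (small M w) c]
    and the second for [w]. *)
Lemma minus_vec_add_even w c : signed_word (rcons w c) ->
  (exists e, add_even e (diagram (minus_vec w)) (diagram (minus_vec (rcons w c)))) /\
  (forall M, M \in [seq `|a|%N | a <- rcons w c] -> all (fun a => `|a|%N <= M) (rcons w c) ->
   exists e, add_even e (diagram (minus_vec (small M (rcons w c))))
                        (diagram (minus_vec (rcons w c)))).
Proof.
have [n] := ubnP (size w); elim: n w c => // n IH w c; rewrite ltnS => sz sw.
have main M : M \in [seq `|a|%N | a <- rcons w c] -> all (fun a => `|a|%N <= M) (rcons w c) ->
  (exists e, add_even e (diagram (minus_vec w)) (diagram (minus_vec (rcons w c)))) /\
  (exists e, add_even e (diagram (minus_vec (small M (rcons w c))))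
                        (diagram (minus_vec (rcons w c)))).
  (* If the last letter is also the largest, both removals coincide and delete a domino of the first
     row or column. *)
  move=> Mw wM; have [e|ne] := eqVneq `|c|%N M.
    rewrite -e in wM *; rewrite small_rcons_eq //.
    suff H : exists e, add_even e (diagram (minus_vec w)) (diagram (minus_vec (rcons w c))) by split.
    have lt := all_lt_last sw wM.
    have c0 : c != 0%R by move: sw; rewrite signed_word_rcons => /and3P [].
    case: (ltrgtP c 0%R) c0 => // c0 _.
      have [r Hr] := minus_vec_min sw lt c0; apply/(add_even_parity Hr).
      by rewrite /even_cell /=; clear; lia.
    have [r Hr] := minus_vec_max sw lt c0; apply/(add_even_parity Hr).
    by rewrite /even_cell /=; clear; lia.
  have [Mw' sw' ss ssc] := small_cube_hyps sw Mw wM ne.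
  rewrite small_rcons_ne //.
  have C := minus_vec_cube sw Mw' wM.
  have szs := size_small Mw'.
  have E1 : exists e, add_even e (diagram (minus_vec (small M w))) (diagram (minus_vec (rcons (small M w) c))).
    by case: (IH _ _ (leq_trans szs sz) ssc).
  have E2 : exists e, add_even e (diagram (minus_vec (small M w))) (diagram (minus_vec w)).
    case/lastP: w sz {sw C szs E1 ss ssc Mw} wM sw' Mw' => // w d; rewrite size_rcons => sz.
    rewrite all_rcons => /andP [_ wM] sw' Mw'.
    by case: (IH w d sz sw') => _; apply.
  by case: (cube_add_even C E1 E2).
have [M Mw wM] : exists2 M, M \in [seq `|a|%N | a <- rcons w c] & all (fun a => `|a|%N <= M) (rcons w c).
  by apply: exists_max_abs; case: (w).
by split=> [|M' Mw' wM']; [case: (main M Mw wM)|case: (main M' Mw' wM')].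
Qed.

(** The new even cell is the first even cell missing from row 0, so it depends only on the even
    cells of the smaller diagram. *)
Lemma same_even_row L Ro L' Ro' r r' : ideal L -> ideal L' -> ideal Ro -> ideal Ro' ->
  add_cells [:: (0, r); (0, r.+1)] L Ro -> add_cells [:: (0, r'); (0, r'.+1)] L' Ro' ->
  same_even L L' -> same_even Ro Ro'.
Proof.
move=> iL iL' iR iR' LR LR' LL.
have first A R s : ideal A -> ideal R -> add_cells [:: (0, s); (0, s.+1)] A R ->
    forall j, A (0, j) = (j < s).
  move=> iA iR0 [_ N H] j; apply/idP/idP => [Aj|js].
    rewrite ltnNge; apply/negP => sj; have : A (0, s) by apply: iA Aj.
    by apply/negP; apply: (allP N); rewrite inE eqxx.
  have : R (0, j) by apply: (iR0 0 s) => //; [exact: ltnW|rewrite H !inE eqxx orbT].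
  rewrite H !inE !xpair_eqE /= => /or3P [//|/eqP e|/eqP e]; move: js; rewrite e; clear; lia.
have F := first _ _ _ iL iR LR; have F' := first _ _ _ iL' iR' LR'.
case: LR => _ _ H; case: LR' => _ _ H' [i j] ec; rewrite H H' LL // !inE !xpair_eqE.
case: i ec => [|i] ec //=; rewrite F'.
have G k : even_cell (0, k) -> (k < r) = (k < r') by move=> ek; rewrite -F -F' LL.
have := G r; have := G r.+1; have := G r'; have := G r'.+1; move: ec; rewrite /even_cell /=.
by clear; lia.
Qed.

Lemma same_even_flip m w : signed_word w -> all (fun a => m <= `|a|%N) w ->
  same_even (diagram (minus_vec w)) (diagram (minus_vec (map (flip m) w))).
Proof.
have [n] := ubnP (size w); elim: n w => // n IH w; rewrite ltnS.
case/lastP: w => [//|w c]; rewrite size_rcons => sz sw wm.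
have sub_ideal v : signed_word v -> ideal (diagram (minus_vec v)).
  by move=> sv; apply/diagram_ideal/minus_vec_uniq.
have sub_flip v : signed_word v -> ideal (diagram (minus_vec (map (flip m) v))).
  by move=> sv; apply: sub_ideal; rewrite signed_word_flip.
have sw' : signed_word w by move: sw; rewrite signed_word_rcons => /and3P [].
have wm' : all (fun a => m <= `|a|%N) w by move: wm; rewrite all_rcons => /andP [].
have c0 : c != 0%R by move: sw; rewrite signed_word_rcons => /and3P [].
have swf : signed_word (map (flip m) (rcons w c)) by rewrite signed_word_flip.
have [M Mw wM] : exists2 M, M \in [seq `|a|%N | a <- rcons w c] & all (fun a => `|a|%N <= M) (rcons w c).
  by apply: exists_max_abs; case: (w).
have [e|ne] := eqVneq `|c|%N M.
  rewrite -e in wM; have lt := all_lt_last sw wM.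
  (* If the last letter is both largest and smallest, it is the only one. The two shapes are a row
     and a column of two cells, whose only even cell is the corner. *)
  have [em|nem] := eqVneq `|c|%N m.
    have w0 : w = [::].
      case: (w) lt wm' => // a s /= /andP [h1 _] /andP [h2 _].
      by move: h1 h2; rewrite em; clear; lia.
    rewrite w0 /= /flip em eqxx; clear -c0; case=> i j.
    rewrite /even_cell /diagram /row_len /minus_vec /RS_shape /RS_tableau /= opprK.
    case: (ltrgtP c 0%R) c0 => // c0 _.
      have -> : (c < - c)%R by clear -c0; lia.
      have -> : (- c < c)%R = false by clear -c0; lia.
      by case: i => [|[|i]] /=; rewrite ?nth_nil; clear; lia.
    have -> : (- c < c)%R by clear -c0; lia.
    have -> : (c < - c)%R = false by clear -c0; lia.
    by case: i => [|[|i]] /=; rewrite ?nth_nil; clear; lia.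
  (* The flip keeps [c], so both words add a domino to the first row, or both to the first
     column. *)
  have fc : flip m c = c by rewrite /flip (negbTE nem).
  have LL := IH w sz sw' wm'.
  rewrite map_rcons fc in swf *.
  have ltf : all (fun a => `|a|%N < `|c|%N) (map (flip m) w).
    by rewrite all_map; apply: sub_all lt => a /=; rewrite absz_flip.
  have iR := sub_ideal _ sw; have iR' := sub_ideal _ swf.
  case: (ltrgtP c 0%R) c0 => // c0 _; last first.
    have [r Hr] := minus_vec_max sw lt c0; have [r' Hr'] := minus_vec_max swf ltf c0.
    by apply: same_even_row Hr Hr' LL; auto.
  have [r Hr] := minus_vec_min sw lt c0; have [r' Hr'] := minus_vec_min swf ltf c0.
  have := same_even_row (ideal_swap (sub_ideal _ sw')) (ideal_swap (sub_flip _ sw'))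
     (ideal_swap iR) (ideal_swap iR') (add_cells_swap Hr) (add_cells_swap Hr') (same_even_swap LL).
  by move=> H d ed; have := H (swap d); rewrite /= swapK even_cell_swap; apply.
have [Mw' _ ss ssc] := small_cube_hyps sw Mw wM ne.
have szs := size_small Mw'.
have fs : small M (map (flip m) w) = map (flip m) (small M w).
  by rewrite /small filter_map; congr map; apply: eq_filter => a /=; rewrite absz_flip.
have Mwf : M \in [seq `|a|%N | a <- map (flip m) w] by rewrite abs_flip.
have wMf : all (fun a => `|a|%N <= M) (map (flip m) (rcons w c)).
  by rewrite all_map; apply: sub_all wM => a /=; rewrite absz_flip.
have C := minus_vec_cube sw Mw' wM.
have swf' := swf; rewrite map_rcons in swf' wMf.
have C' := minus_vec_cube swf' Mwf wMf.
rewrite fs -!map_rcons in C'.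
have last_even v d : signed_word (rcons v d) ->
    exists e, add_even e (diagram (minus_vec v)) (diagram (minus_vec (rcons v d))).
  by move=> sv; case: (minus_vec_add_even sv).
have max_even v : signed_word v -> M \in [seq `|a|%N | a <- v] -> all (fun a => `|a|%N <= M) v ->
    exists e, add_even e (diagram (minus_vec (small M v))) (diagram (minus_vec v)).
  by case/lastP: v => // v d sv Mv vM; case: (minus_vec_add_even sv) => _; apply.
have wM' : all (fun a => `|a|%N <= M) w by move: wM; rewrite all_rcons => /andP [].
have ssm : all (fun a => m <= `|a|%N) (small M w).
  by apply/allP => a; rewrite mem_filter => /andP [_] /(allP wm').
have szsn : size (small M w) < n := leq_trans szs (ltnW sz).
apply: (same_even_step _ _ _ _ C C'); auto.
- by rewrite map_rcons; apply: last_even; rewrite -map_rcons signed_word_flip.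
- rewrite -fs; apply: max_even => //; first by rewrite signed_word_flip.
  by move: wMf; rewrite all_rcons => /andP [].
- apply: IH => //; first by rewrite size_rcons; apply: leq_ltn_trans szs sz.
  by rewrite all_rcons ssm andbT; move: wm; rewrite all_rcons => /andP [].
(* The flip changes the row sums for [L] and [Ro] by at most one and in the same direction; hence
   the numbers of cells added between them differ by at most one. *)
move=> k l l' LR LR'.
have := row_sum_add_cells k LR; have := row_sum_add_cells k LR'.
have ssub : {subset small M w <= rcons w c}.
  by move=> a; rewrite mem_filter mem_rcons inE => /andP [_ ->]; rewrite orbT.
have b1 := row_sum_flip_le1 k sw wm; have b2 := row_sum_flip_le1 k ss ssm.
have inv v : map (flip m) (map (flip m) v) = v.
  by rewrite -map_comp map_id_in // => a _; apply: flipK.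
have wmf : all (fun a => m <= `|a|%N) (map (flip m) (rcons w c)).
  by rewrite all_map; apply: sub_all wm => a /=; rewrite absz_flip.
have ssmf : all (fun a => m <= `|a|%N) (map (flip m) (small M w)).
  by rewrite all_map; apply: sub_all ssm => a /=; rewrite absz_flip.
have ssf : signed_word (map (flip m) (small M w)) by rewrite signed_word_flip.
have b3 := row_sum_flip_le1 k swf wmf; have b4 := row_sum_flip_le1 k ssf ssmf.
rewrite !inv in b3 b4.
case: (row_sum_flip sw wm ssub ss) => /(_ k) [h1 h2]; move: b1 b2 b3 b4 h1 h2; clear; lia.
Qed.

(** * Inverses *)

Lemma same_even_ev_part x y : same_even (diagram x) (diagram y) ->
  ev_part (RS_shape x) =1 ev_part (RS_shape y).
Proof.
move=> H j; rewrite /ev_part -/(row_len x j) -/(row_len y j).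
have G k : ~~ odd (j + k) -> (k < row_len x j) = (k < row_len y j) by move=> jk; apply: (H (j, k)).
(* Of two consecutive cells in a row one is even, so testing at each length and its successor
   suffices. *)
have := G (row_len x j); have := G (row_len x j).+1.
have := G (row_len y j); have := G (row_len y j).+1.
by clear; case: ifP; lia.
Qed.

Lemma increasing_pairwise (R : rel int) s x y : increasing s -> pairwise R s ->
  x \in s -> y \in s -> (x < y)%R -> R x y.
Proof.
elim: s => //= a s IH /andP [as_ is_] /andP [Ra Rs].
rewrite !inE => /predU1P [->|xs] /predU1P [->|ys] xy.
- by rewrite ltxx in xy.
- exact: (allP Ra).
- by have := lt_trans xy (allP as_ x xs); rewrite ltxx.
- exact: IH.
Qed.

(** An increasing subsequence is a set of pairs [(i, f i)] increasing in both coordinates, which is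
    symmetric in [f] and its inverse. So [a] in the word of [g] gets the color of [f a]. *)
Lemma greene_inverse k m s (f g : int -> int) : increasing s ->
  {in s, forall i, f i \in s} -> {in s, forall i, g i \in s} ->
  {in s, cancel f g} -> {in s, cancel g f} ->
  greene k (map f s) m -> greene k (map g s) m.
Proof.
move=> is_ fs gs fK gK [col P C].
have Us : uniq s by apply: pairwise_uniq is_ => a; rewrite ltxx.
exists (fun a => col (f a)); last first.
  have pf : perm_eq (map f s) s.
    have Uf : uniq (map f s) by rewrite map_inj_in_uniq //; apply: can_in_inj fK.
    apply: uniq_perm => //; apply: (uniq_min_size Uf _ _).2; last by rewrite size_map.
    by move=> b /mapP [a as_ ->]; apply: fs.
  apply: leq_trans C _; rewrite (permP pf) count_map leq_eqVlt; apply/orP; left.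
  by apply/eqP/eq_in_count => a as_ /=; rewrite gK.
rewrite pairwise_map; apply: (sub_in_pairwise (P := mem s)) (is_); last by apply/allP.
move=> a b as_ bs ab; apply/color_ltP; rewrite !gK // => e l.
(* If [g b < g a], the word of [f] has [b] before [a] in the same color, whence [b < a], a
   contradiction. *)
case: (ltgtP (g a) (g b)) => // [ba|eab]; last first.
  by move: ab; rewrite -(gK a as_) eab gK // ltxx.
move: P; rewrite pairwise_map => P.
have := increasing_pairwise is_ P (gs b bs) (gs a as_) ba.
rewrite /= !gK // => /color_ltP /(_ (esym e)); rewrite -e => /(_ l) ba'.
by have := lt_trans ab ba'; rewrite ltxx.
Qed.

(** The doubled word of the identity; the doubled word of [w] lists the values of [w] along it. *)
Definition positions (n : nat) : seq int := minus_vec (map Posz (iota 1 n)).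

Lemma mem_positions n j : (j \in positions n) = (0 < `|j| <= n)%N.
Proof.
rewrite /positions mem_minus_vec -map_comp map_id_in ?mem_iota ?add1n //.
Qed.

Lemma increasing_positions n : increasing (positions n).
Proof.
have inc : increasing (map Posz (iota 1 n)).
  rewrite pairwise_map; apply/(pairwiseP 0) => i j; rewrite !inE size_iota => Hi Hj ij /=.
  by rewrite !nth_iota //; move: ij; clear; lia.
rewrite /positions minus_vecE pairwise_cat inc andbT; apply/andP; split.
  apply/allrelP => a b; rewrite mem_star => /mapP [i + ei] /mapP [j + ->].
  by rewrite !mem_iota; move: ei; clear; lia.
rewrite /star pairwise_map pairwise_rev; apply: sub_pairwise inc => a b /=.
by rewrite ltrN2.
Qed.

(** The inverse of [w] at [j]: for [j] in [positions n], exactly one of [j] and [-j] occurs in the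
    window. *)
Definition inverse_app (w : seq int) (j : int) : int :=
  if j \in w then Posz (index j w).+1 else (- Posz (index (- j)%R w).+1)%R.

Lemma signed_perm_size n w : signed_perm n w -> size w = n.
Proof. by case/andP => /eqP. Qed.

Lemma signed_perm_abs n w : signed_perm n w -> perm_eq [seq `|a|%N | a <- w] (iota 1 n).
Proof. by case/andP. Qed.

Lemma signed_perm_word n w : signed_perm n w ->
  signed_word w.
Proof.
move=> wP; rewrite /signed_word (perm_uniq (signed_perm_abs wP)) iota_uniq /=; apply/negP => /(map_f absz).
by rewrite (perm_mem (signed_perm_abs wP)) mem_iota.
Qed.

Lemma mem_signed_perm n w a : signed_perm n w ->
  a \in w -> (0 < `|a| <= n)%N.
Proof. move=> wP; by move/(map_f absz); rewrite (perm_mem (signed_perm_abs wP)) mem_iota add1n. Qed.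

Lemma signed_perm_ge1 n w : signed_perm n w ->
  all (fun a => 1 <= `|a|)%N w.
Proof. move=> wP; by apply/allP => a /(mem_signed_perm wP) /andP []. Qed.

Lemma signed_perm_or n w j : signed_perm n w ->
  j \in positions n -> j \in w \/ (j \notin w /\ (- j)%R \in w).
Proof.
move=> wP; rewrite mem_positions => jn; have : `|j|%N \in [seq `|a|%N | a <- w].
  by rewrite (perm_mem (signed_perm_abs wP)) mem_iota add1n.
case/mapP => a aw e; have [ea|ea] : a = j \/ a = (- j)%R by move: e; clear; lia.
  by left; rewrite -ea.
right; rewrite -ea; split=> //; apply/negP => jw; apply: (signed_word_opp (signed_perm_word wP) jw).
by rewrite -ea.
Qed.

Lemma sp_app_positions n w j : signed_perm n w ->
  j \in positions n -> sp_app w j \in positions n.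
Proof.
move=> wP; rewrite !mem_positions => /andP [j0 jn].
have : nth 0%R w `|j|.-1 \in w by rewrite mem_nth // (signed_perm_size wP); move: j0 jn; clear; lia.
by move/(mem_signed_perm wP); rewrite /sp_app; case: ifP; rewrite ?abszN.
Qed.

Lemma inverse_app_positions n w j : signed_perm n w ->
  j \in positions n -> inverse_app w j \in positions n.
Proof.
move=> wP jp; rewrite mem_positions /inverse_app.
have [jw|[nj jw]] := (signed_perm_or wP) jp.
  by rewrite jw /= -(signed_perm_size wP) index_mem.
by rewrite (negbTE nj) abszN /= -(signed_perm_size wP) index_mem.
Qed.

Lemma sp_appK n w : signed_perm n w ->
  {in positions n, cancel (sp_app w) (inverse_app w)}.
Proof.
move=> wP j; rewrite mem_positions => /andP [j0 jn].
have lt : `|j|.-1 < size w by rewrite (signed_perm_size wP); move: j0 jn; clear; lia.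
have aw : nth 0%R w `|j|.-1 \in w by rewrite mem_nth.
have Uw := signed_word_uniq (signed_perm_word wP).
rewrite /sp_app; case: ifP => jpos; rewrite /inverse_app.
  by rewrite aw index_uniq //; move: j0 jpos; clear; lia.
case: ifP => [naw|_]; first by case: (signed_word_opp (signed_perm_word wP) aw naw).
by rewrite opprK index_uniq //; move: j0 jpos; clear; lia.
Qed.

Lemma inverse_appK n w : signed_perm n w ->
  {in positions n, cancel (inverse_app w) (sp_app w)}.
Proof.
move=> wP j jp; rewrite /inverse_app; have [jw|[nj jw]] := (signed_perm_or wP) jp.
  by rewrite jw /sp_app /= nth_index.
by rewrite (negbTE nj) /sp_app abszN /= nth_index // opprK.
Qed.

Lemma inverse_appN n w j : signed_perm n w ->
  j \in positions n -> inverse_app w (- j)%R = (- inverse_app w j)%R.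
Proof.
move=> wP jp; rewrite /inverse_app; have [jw|[nj jw]] := (signed_perm_or wP) jp.
  rewrite jw opprK; case: ifP => // njw.
  by case: (signed_word_opp (signed_perm_word wP) jw njw).
by rewrite jw (negbTE nj) opprK.
Qed.

Definition inverse_window (n : nat) (w : seq int) : seq int :=
  [seq inverse_app w (Posz i) | i <- iota 1 n].

Lemma minus_vec_inverse n w : signed_perm n w ->
  minus_vec (inverse_window n w) = map (inverse_app w) (positions n).
Proof.
move=> wP; rewrite /positions /inverse_window /minus_vec map_cat -!map_rev -!map_comp; congr (_ ++ _).
apply/eq_in_map => i; rewrite mem_rev mem_iota add1n => Hi /=.
by rewrite (inverse_appN wP) // mem_positions.
Qed.

Lemma minus_vec_sp_app n w : signed_perm n w ->
  minus_vec w = map (sp_app w) (positions n).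
Proof.
move=> wP; have e : w = [seq sp_app w (Posz i) | i <- iota 1 n].
  have sz := signed_perm_size wP.
  apply: (@eq_from_nth _ 0%R); first by rewrite size_map size_iota.
  by move=> i; rewrite sz => Hi; rewrite (nth_map 0) ?size_iota // nth_iota.
rewrite {1}e /positions /minus_vec map_cat -!map_rev -!map_comp; congr (_ ++ _).
by apply/eq_in_map => -[|i]; rewrite mem_rev mem_iota.
Qed.

Lemma signed_word_inverse n w : signed_perm n w ->
  signed_word (inverse_window n w).
Proof.
move=> wP; apply/andP; split.
  rewrite /inverse_window -map_comp map_inj_in_uniq ?iota_uniq // => i j.
  rewrite !mem_iota !add1n /= => Hi Hj e.
  have pi : Posz i \in positions n by rewrite mem_positions.
  have pj : Posz j \in positions n by rewrite mem_positions.
  have pnj : (- Posz j)%R \in positions n by rewrite mem_positions abszN.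
  have inj := can_in_inj (inverse_appK wP).
  have [e1|] : inverse_app w (Posz i) = inverse_app w (Posz j) \/
      inverse_app w (Posz i) = (- inverse_app w (Posz j))%R by move: e; clear; lia.
    by have [] := inj _ _ pi pj e1.
  rewrite -(inverse_appN wP) // => e1; have := inj _ _ pi pnj e1; move: Hi Hj; clear; lia.
apply/negP => /mapP [i]; rewrite mem_iota add1n => Hi e.
have : inverse_app w (Posz i) \in positions n by apply: (inverse_app_positions wP); rewrite mem_positions.
by rewrite -e mem_positions.
Qed.

Lemma inverse_window_ge1 n w : signed_perm n w ->
  all (fun a => 1 <= `|a|)%N (inverse_window n w).
Proof.
move=> wP; apply/allP => a /mapP [i]; rewrite mem_iota add1n => Hi ->.
have : inverse_app w (Posz i) \in positions n by apply: (inverse_app_positions wP); rewrite mem_positions.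
by rewrite mem_positions => /andP [].
Qed.

(** The two doubled words list the values of mutually inverse maps along [positions n], so their
    Greene invariants agree. *)
Lemma row_len_inverse n w : signed_perm n w ->
  row_len (minus_vec w) =1 row_len (minus_vec (inverse_window n w)).
Proof.
move=> wP; apply: eq_row_len => [||k m].
- exact: minus_vec_uniq (signed_perm_word wP).
- exact: minus_vec_uniq (signed_word_inverse wP).
have inc := increasing_positions n; have fK := sp_appK wP; have gK := inverse_appK wP.
have fs : {in positions n, forall i, sp_app w i \in positions n}.
  by move=> i; apply: sp_app_positions.
have gs : {in positions n, forall i, inverse_app w i \in positions n}.
  by move=> i; apply: inverse_app_positions.
rewrite (minus_vec_inverse wP) (minus_vec_sp_app wP).
by split; apply: greene_inverse.
Qed.

(** * Products with the generator [t] *)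

Lemma sp_mul_t_left n w : signed_perm n w -> sp_mul n (gen_t n) w = map (flip 1) w.
Proof.
move=> wP; have sz : size w = n by case/andP: wP => /eqP.
apply: (@eq_from_nth _ 0%R); first by rewrite !size_map size_iota.
move=> i; rewrite size_map size_iota => Hi.
rewrite (nth_map 0) ?size_iota // (nth_map 0%R) ?sz // nth_iota // add1n.
set a := sp_app w (Posz i.+1); have -> : nth 0%R w i = a by [].
have /andP [a0 an] : (0 < `|a| <= n)%N by apply: (mem_signed_perm wP); rewrite mem_nth ?sz.
rewrite /sp_app /gen_t (nth_map 0) ?size_iota ?nth_iota; try by move: a0 an; clear; lia.
by rewrite add1n prednK // /flip; case: ifP => h; case: eqP => h1; move: a0 h h1; clear; lia.
Qed.

Lemma sp_mul_t_right n a s : signed_perm n (a :: s) ->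
  sp_mul n (a :: s) (gen_t n) = (- a)%R :: s.
Proof.
move=> wP; have sz : size (a :: s) = n by case/andP: wP => /eqP.
apply: (@eq_from_nth _ 0%R); first by rewrite !size_map size_iota.
move=> i; rewrite size_map size_iota => Hi.
rewrite (nth_map 0) ?size_iota // nth_iota // add1n.
have -> : sp_app (gen_t n) (Posz i.+1) = if i == 0 then (-1)%R else Posz i.+1.
  by rewrite /sp_app /gen_t /= (nth_map 0) ?size_iota ?nth_iota.
by case: i Hi.
Qed.

Lemma signed_perm_opp_head n a s : signed_perm n (a :: s) -> signed_perm n ((- a)%R :: s).
Proof. by rewrite /signed_perm /= abszN. Qed.

(** This is the identity $(wt)^{-1} = t w^{-1}$ on windows. *)
Lemma inverse_window_opp_head n a s : signed_perm n (a :: s) ->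
  inverse_window n ((- a)%R :: s) = map (flip 1) (inverse_window n (a :: s)).
Proof.
move=> wP; rewrite /inverse_window -map_comp; apply/eq_in_map => i.
rewrite mem_iota add1n => Hi /=; have sw := signed_perm_word wP.
move: (Posz i) => j {i Hi}; rewrite /inverse_app /= !inE.
have nas : (- a)%R \notin s.
  by apply/negP => h; apply: (signed_word_opp sw (a := a)); rewrite inE ?eqxx ?h ?orbT.
have as_ : a \notin s by have := signed_word_uniq sw; rewrite /= => /andP [].
have na : (a == - a)%R = false.
  by case/andP: sw => _; rewrite inE negb_or => /andP [h _]; move: h; clear; lia.
have [->|ja] := eqVneq j a; first by rewrite na (negbTE as_) eqxx.
have [->|jna] := eqVneq j (- a)%R.
  by rewrite opprK (negbTE nas) /= eqxx.
rewrite eqr_opp (eq_sym a j) (negbTE ja) -eqr_oppLR (eq_sym _ j) (negbTE jna) /=.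
by case: ifP => _; rewrite /flip ?abszN.
Qed.

Theorem mainTheorem4 (n : nat) (w : seq int) :
  (0 < n)%N -> signed_perm n w ->
  ev_part (RS_shape (minus_vec w)) =1 ev_part (RS_shape (minus_vec (sp_mul n (gen_t n) w))) /\
  ev_part (RS_shape (minus_vec w)) =1 ev_part (RS_shape (minus_vec (sp_mul n w (gen_t n)))).
Proof.
move=> n0 wP; split.
  apply: same_even_ev_part; rewrite sp_mul_t_left //.
  by apply: same_even_flip; [exact: signed_perm_word wP|exact: signed_perm_ge1 wP].
case: w wP => [|a s] wP; first by case/andP: wP n0 => /eqP <-.
rewrite sp_mul_t_right //; have wP' := signed_perm_opp_head wP.
apply: same_even_ev_part => c ec.
(* Inverting both permutations preserves the shapes and turns the sign change of the first letter
   into that of the letter of absolute value 1. *)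
rewrite /diagram (row_len_inverse wP) (row_len_inverse wP') inverse_window_opp_head //.
apply: (same_even_flip _ _ ec); [exact: signed_word_inverse wP|exact: inverse_window_ge1 wP].
Qed.
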